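(* Let $n\ge 1$ be an integer and $k$ a field. Let $\mathcal{C}$ be a $k$-linear Hom-finite $(n+2)$-angulated category with split idempotents and $n$-suspension functor $\Sigma^n$. Let $T$ be an Oppermann-Thomas cluster tilting object of $\mathcal{C}$ with endomorphism algebra $\Lambda=\operatorname{End}_{\mathcal{C}}(T)$, and let $\mathcal{D}$ be the essential image of the functor $\mathcal{C}(T,-)\colon\mathcal{C}\to\operatorname{mod}\Lambda$. Then: (a) Let $M$ be an object of $\mathcal{C}$ with $\operatorname{add}M\cap\operatorname{add}\Sigma^nT=\{0\}$. Then $M$ is $\Sigma^nT$-$n$-rigid in $\mathcal{C}$ if and only if $\mathcal{C}(T,M)$ is $\tau_n$-rigid in $\mathcal{D}$. (b) Decompose any object $M$ of $\mathcal{C}$ as $M=M_0\oplus\Sigma^nT_M$, where $T_M\in\operatorname{add}T$ and $\Sigma^nT_M$ is a maximal direct summand of $M$ belonging to $\operatorname{add}\Sigma^nT$. Then the correspondence $$M\longmapsto\big(\mathcal{C}(T,M_0),\ \mathcal{C}(T,T_M)\big)$$ gives a bijection between the set of isomorphism classes of $\Sigma^nT$-$n$-rigid objects in $\mathcal{C}$ and the set of isomorphism classes of $\tau_n$-rigid pairs in $\mathcal{D}$. (c) The functor $\mathcal{C}(T,-)$ induces, via the correspondence in (b), a bijection between the set of isomorphism classes of maximal $\Sigma^nT$-$n$-rigid objects in $\mathcal{C}$ and the set of isomorphism classes of support $\tau_n$-tilting pairs in $\mathcal{D}$. (d) The functor $\mathcal{C}(T,-)$ induces, via the correspondence in (b),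 a bijection between the set of isomorphism classes of $\Sigma^nT$-$n$-self-perpendicular objects in $\mathcal{C}$ and the set of isomorphism classes of maximal $\tau_n$-rigid pairs in $\mathcal{D}$.
   Context: **$(n+2)$-angulated categories** (Geiss-Keller-Oppermann). An $(n+2)$-angulated category is an additive category $\mathcal{C}$ with an automorphism $\Sigma^n$ (the $n$-suspension functor; the symbol is a single functor, not necessarily an $n$-th power) and a class of sequences $X_0\xrightarrow{d_0}X_1\to\cdots\to X_{n+1}\xrightarrow{d_{n+1}}\Sigma^nX_0$, called $(n+2)$-angles, such that: (F1) the class is closed under isomorphisms, direct sums and direct summands; for every $X$ the sequence $X\xrightarrow{1}X\to0\to\cdots\to0\to\Sigma^nX$ is an $(n+2)$-angle; every morphism $X_0\to X_1$ is the first morphism of an $(n+2)$-angle. (F2) A sequence $X_0\xrightarrow{d_0}X_1\xrightarrow{d_1}\cdots\to X_{n+1}\xrightarrow{d_{n+1}}\Sigma^nX_0$ is an $(n+2)$-angle iff $X_1\xrightarrow{d_1}\cdots\to X_{n+1}\xrightarrow{d_{n+1}}\Sigma^nX_0\xrightarrow{(-1)^n\Sigma^nd_0}\Sigma^nX_1$ is one. (F3) Given two $(n+2)$-angles $X_\bullet,Y_\bullet$ and $\varphi_0\colon X_0\to Y_0$, $\varphi_1\colon X_1\to Y_1$ commuting with the first morphisms, there are $\varphi_2,\dots,\varphi_{n+1}$ completing them to a morphism $(\varphi_0,\dots,\varphi_{n+1},\Sigma^n\varphi_0)$ of sequences. (F4) In (F3) the completion can be chosen so that the mapping cone $X_1\oplus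 Y_0\to X_2\oplus Y_1\to\cdots\to\Sigma^nX_0\oplus Y_{n+1}\to\Sigma^nX_1\oplus\Sigma^nY_0$ is an $(n+2)$-angle. **Notation.** $\mathcal{C}(X,Y)=\operatorname{Hom}_{\mathcal{C}}(X,Y)$. $\operatorname{add}M$ is the full subcategory of direct summands of finite direct sums of copies of $M$. $\operatorname{mod}\Lambda$ is the category of finite-dimensional right $\Lambda$-modules and $\operatorname{proj}\Lambda$ the full subcategory of projectives. For an object $Z$, $[Z](X,Y)$ is the subgroup of $\mathcal{C}(X,Y)$ of morphisms factoring through an object of $\operatorname{add}Z$. **Oppermann-Thomas cluster tilting.** An object $T\in\mathcal{C}$ is (Oppermann-Thomas) cluster tilting if $\mathcal{C}(T,\Sigma^nT)=0$ and for every $C\in\mathcal{C}$ there is an $(n+2)$-angle $T_0\to T_1\to\cdots\to T_n\to C\to\Sigma^nT_0$ with $T_0,\dots,T_n\in\operatorname{add}T$. **The category $\mathcal{D}$.** It is known that $\mathcal{D}$ (as a full subcategory) is an $n$-cluster tilting subcategory of $\operatorname{mod}\Lambda$, hence $n$-abelian, and that $\mathcal{C}(T,-)$ induces an equivalence $\mathcal{C}/\operatorname{add}\Sigma^nT\simeq\mathcal{D}$. The $n$-Auslander-Reiten translation is $\tau_n=\tau\,\Omega^{n-1}$; explicitly, if $P_n\to P_{n-1}\to\cdots\to P_0\to M\to0$ is the start of a minimal projective resolution of $M$, then $\tau_nM=\operatorname{Ker}(\nu P_n\to\nu P_{n-1})$, with $\nu=\operatorname{Hom}_k(\operatorname{Hom}_\Lambda(-,\Lambda),k)$.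 **Relative notions (for the fixed $T$).** An object $X\in\mathcal{C}$ is *$\Sigma^nT$-$n$-rigid* if $[\Sigma^nT](X,\Sigma^nX)=0$. It is *maximal $\Sigma^nT$-$n$-rigid* if it is $\Sigma^nT$-$n$-rigid and, for every $M\in\mathcal{C}$, $[\Sigma^nT](X\oplus M,\Sigma^n(X\oplus M))=0$ implies $M\in\operatorname{add}X$. It is *$\Sigma^nT$-$n$-self-perpendicular* if $\operatorname{add}X=\{M\in\mathcal{C}\mid[\Sigma^nT](X,\Sigma^nM)=0=[\Sigma^nT](M,\Sigma^nX)\}$. **Pairs in $\mathcal{D}$.** Consider pairs $(M,P)$ with $M\in\mathcal{D}$, $P\in\operatorname{proj}\Lambda$; two pairs are isomorphic if both components are. - $M$ is *$\tau_n$-rigid* if $\operatorname{Hom}_\Lambda(M,\tau_nM)=0$; $(M,P)$ is a *$\tau_n$-rigid pair* if $M$ is $\tau_n$-rigid and $\operatorname{Hom}_\Lambda(P,M)=0$. - $(M,P)$ is a *maximal $\tau_n$-rigid pair* if (i) for every $N\in\mathcal{D}$: $N\in\operatorname{add}M$ iff $\operatorname{Hom}_\Lambda(M,\tau_nN)=0$, $\operatorname{Hom}_\Lambda(N,\tau_nM)=0$ and $\operatorname{Hom}_\Lambda(P,N)=0$; and (ii) for every $Q\in\operatorname{proj}\Lambda$: $Q\in\operatorname{add}P$ iff $\operatorname{Hom}_\Lambda(Q,M)=0$. - A $\tau_n$-rigid pair $(M,P)$ is a *support $\tau_n$-tilting pair* if (i) for every $N\in\mathcal{D}$, if $(M\oplus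 N,P)$ is a $\tau_n$-rigid pair then $N\in\operatorname{add}M$; and (ii) for every $Q\in\operatorname{proj}\Lambda$: $Q\in\operatorname{add}P$ iff $\operatorname{Hom}_\Lambda(Q,M)=0$. *)

(* Defs.v *)
From HB Require Import structures.
From mathcomp Require Import all_boot all_algebra.
From Stdlib Require Import ClassicalEpsilon.

Set Implicit Arguments.
Unset Strict Implicit.
Unset Printing Implicit Defensive.

Import GRing.Theory.
Local Open Scope ring_scope.

(* ------------------------------------------------------------------------ *)
(* A vectType is a finite dimensional vector space, so taking Hom-spaces in *)
(* vectType k expresses both k-linearity and Hom-finiteness.                *)
(* comp g f is g after f.  Chosen zero object and binary biproducts are   *)
(* part of the data.                                                        *)
(* ------------------------------------------------------------------------ *)
Record lincat (k : fieldType) := LinCat {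
  ob :> Type;
  Hom : ob -> ob -> vectType k;
  idm : forall X, Hom X X;
  comp : forall X Y Z, Hom Y Z -> Hom X Y -> Hom X Z;
  compA : forall X Y Z W (h : Hom Z W) (g : Hom Y Z) (f : Hom X Y),
    comp h (comp g f) = comp (comp h g) f;
  comp1m : forall X Y (f : Hom X Y), comp (idm Y) f = f;
  compm1 : forall X Y (f : Hom X Y), comp f (idm X) = f;
  comp_linr : forall X Y Z (g : Hom Y Z), linear (fun f : Hom X Y => comp g f);
  comp_linl : forall X Y Z (f : Hom X Y), linear (fun g : Hom Y Z => comp g f);
  zob : ob;
  zobP : idm zob = 0;
  bip : ob -> ob -> ob;
  in1 : forall X Y, Hom X (bip X Y);
  in2 : forall X Y, Hom Y (bip X Y);
  pr1 : forall X Y, Hom (bip X Y) X;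
  pr2 : forall X Y, Hom (bip X Y) Y;
  pr1_in1 : forall X Y, comp (pr1 X Y) (in1 X Y) = idm X;
  pr2_in2 : forall X Y, comp (pr2 X Y) (in2 X Y) = idm Y;
  pr1_in2 : forall X Y, comp (pr1 X Y) (in2 X Y) = 0;
  pr2_in1 : forall X Y, comp (pr2 X Y) (in1 X Y) = 0;
  bip_id : forall X Y,
    comp (in1 X Y) (pr1 X Y) + comp (in2 X Y) (pr2 X Y) = idm (bip X Y)
}.

Arguments Hom {k l} _ _.
Arguments idm {k l} _.
Arguments zob {k} l.
Arguments in1 {k l} _ _.
Arguments in2 {k l} _ _.
Arguments pr1 {k l} _ _.
Arguments pr2 {k l} _ _.

Notation "g ∘ f" := (comp g f) (at level 40, left associativity).
Notation "X ⊕ Y" := (bip X Y) (at level 50, left associativity).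

Section Category.
Variables (k : fieldType) (C : lincat k).
Implicit Types X Y Z W : C.

Definition is_iso X Y (f : Hom X Y) : Prop :=
  exists g : Hom Y X, g ∘ f = idm X /\ f ∘ g = idm Y.

Definition iso X Y : Prop := exists f : Hom X Y, is_iso f.

Definition split_idempotents : Prop :=
  forall X (e : Hom X X), e ∘ e = e ->
    exists Y (r : Hom X Y) (s : Hom Y X), s ∘ r = e /\ r ∘ s = idm Y.

Fixpoint cpow (M : C) (m : nat) : C :=
  if m is m'.+1 then M ⊕ cpow M m' else zob C.

Definition summand X M : Prop := exists Y, iso (X ⊕ Y) M.

(* X is in add M *)
Definition addob M X : Prop := exists m, summand X (cpow M m).

Definition factors_add Z X Y (f : Hom X Y) : Prop :=
  exists W, addob Z W /\ exists (g : Hom W Y) (h : Hom X W), f = g ∘ h.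

(* [Z](X, Y) = 0 *)
Definition ideal0 Z X Y : Prop := forall f : Hom X Y, factors_add Z f -> f = 0.

Definition mcopair X Y Z (f : Hom X Z) (g : Hom Y Z) : Hom (X ⊕ Y) Z :=
  f ∘ pr1 X Y + g ∘ pr2 X Y.

Definition mpair X Y Z (f : Hom X Y) (g : Hom X Z) : Hom X (Y ⊕ Z) :=
  in1 Y Z ∘ f + in2 Y Z ∘ g.

(* ------------------------------------------------------------------------ *)
(* seqn m X Z: sequences X -> Y_1 -> ... -> Y_m -> Z of composable          *)
(* morphisms with m intermediate objects.                                   *)
(* ------------------------------------------------------------------------ *)
Fixpoint seqn (m : nat) X Z : Type :=
  if m is m'.+1 then {Y : C & (Hom X Y * seqn m' Y Z)%type} else Hom X Z.

Definition scons m X Y Z (d : Hom X Y) (p : seqn m Y Z) : seqn m.+1 X Z :=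
  existT _ Y (d, p).

Fixpoint srcons m {X Z W} : seqn m X Z -> Hom Z W -> seqn m.+1 X W :=
  match m with
  | 0 => fun d h => scons (m := 0) d h
  | m'.+1 => fun s h => scons (projT2 s).1 (srcons (projT2 s).2 h)
  end.

Fixpoint spost m {X Z W} : seqn m X Z -> Hom Z W -> seqn m X W :=
  match m with
  | 0 => fun d h => h ∘ d
  | m'.+1 => fun s h => scons (projT2 s).1 (spost (projT2 s).2 h)
  end.

(* X -> 0 -> ... -> 0 -> Z, with m zeros *)
Fixpoint szero m {X Z} : seqn m X Z :=
  match m with
  | 0 => 0
  | m'.+1 => scons (0 : Hom X (zob C)) (szero m')
  end.

Fixpoint smid_all (P : C -> Prop) m {X Z} : seqn m X Z -> Prop :=
  match m with
  | 0 => fun _ => True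
  | m'.+1 => fun s => P (projT1 s) /\ smid_all P (projT2 s).2
  end.

Fixpoint ssum m {X Z X' Z'} :
    seqn m X Z -> seqn m X' Z' -> seqn m (X ⊕ X') (Z ⊕ Z') :=
  match m with
  | 0 => fun d d' => mcopair (in1 Z Z' ∘ d) (in2 Z Z' ∘ d')
  | m'.+1 => fun s s' =>
      let: existT Y (d, p) := s in let: existT Y' (d', p') := s' in
      scons (mcopair (in1 Y Y' ∘ d) (in2 Y Y' ∘ d')) (ssum p p')
  end.

Fixpoint scomps m {X Z X' Z'} : seqn m X Z -> seqn m X' Z' -> Type :=
  match m with
  | 0 => fun _ _ => unit
  | m'.+1 => fun s s' => (Hom (projT1 s) (projT1 s') *
                          scomps (projT2 s).2 (projT2 s').2)%type
  end.

Fixpoint scommutes m {X Z X' Z'} : forall (s : seqn m X Z) (s' : seqn m X' Z'),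
    Hom X X' -> scomps s s' -> Hom Z Z' -> Prop :=
  match m with
  | 0 => fun d d' a _ b => b ∘ d = d' ∘ a
  | m'.+1 => fun s s' a phi b =>
      phi.1 ∘ (projT2 s).1 = (projT2 s').1 ∘ a /\
      scommutes (s := (projT2 s).2) (s' := (projT2 s').2) phi.1 phi.2 b
  end.

Fixpoint sall_iso m {X Z X' Z'} : forall (s : seqn m X Z) (s' : seqn m X' Z'),
    scomps s s' -> Prop :=
  match m with
  | 0 => fun _ _ _ => True
  | m'.+1 => fun s s' phi =>
      is_iso phi.1 /\ sall_iso (s := (projT2 s).2) (s' := (projT2 s').2) phi.2
  end.

(* Tail of a mapping cone.  Given A -> A_1 -> ... -> A_m -> Z (maps d),      *)
(* B0 -e-> B -> B_1 -> ... -> B_m -> Z' and vertical maps c : A -> B and     *)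
(* phi_i : A_i -> B_i, this is the sequence                                  *)
(*    A ⊕ B0 -> A_1 ⊕ B -> ... -> A_m ⊕ B_(m-1) -> Z ⊕ B_m -> W            *)
(* whose maps are the matrices (-d, 0; phi, e), except for the last one,     *)
(* which is (u, v \o B_m -> Z').                                             *)
Fixpoint scone m {A Z B0 B Z' W} : forall (p : seqn m A Z) (q : seqn m B Z'),
    Hom B0 B -> Hom A B -> scomps p q -> Hom Z W -> Hom Z' W ->
    seqn m.+1 (A ⊕ B0) W :=
  match m with
  | 0 => fun d d' e c _ u v =>
      scons (m := 0) (mcopair (mpair (- d) c) (in2 Z B ∘ e))
        (mcopair u (v ∘ d'))
  | m'.+1 => fun p q e c phi u v =>
      scons (mcopair (mpair (- (projT2 p).1) c) (in2 (projT1 p) B ∘ e))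
        (scone (p := (projT2 p).2) (q := (projT2 q).2)
               (projT2 q).1 phi.1 phi.2 u v)
  end.

(* An automorphism is given as a functor bijective on objects and on        *)
(* morphisms.  No k-linearity is required of it, only additivity.           *)
Record automorphism := Automorphism {
  aob :> C -> C;
  amor : forall X Y, {additive Hom X Y -> Hom (aob X) (aob Y)};
  amor_id : forall X, amor X X (idm X) = idm (aob X);
  amor_comp : forall X Y Z (g : Hom Y Z) (f : Hom X Y),
    amor X Z (g ∘ f) = amor Y Z g ∘ amor X Y f;
  aob_bij : bijective aob;
  amor_bij : forall X Y, bijective (amor X Y)
}.

Arguments amor a {X Y}.

Definition susp_sum (S : automorphism) X Y : Hom (S X ⊕ S Y) (S (X ⊕ Y)) :=
  mcopair (amor S (in1 X Y)) (amor S (in2 X Y)).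

(* ------------------------------------------------------------------------ *)
(* (n+2)-angulations, after Geiss-Keller-Oppermann.  An element of          *)
(* seqn n.+1 X (S X) is X_0 -> X_1 -> ... -> X_(n+1) -> S X_0 with X_0 = X. *)
(* The mapping cone of phi is the one of Geiss-Keller-Oppermann, with maps  *)
(*   (-d_(i+1), 0; phi_(i+1), e_i), the last one being                      *)
(*   (-S d_0, 0; S phi_0, e_(n+1)) : S X_0 ⊕ Y_(n+1) -> S X_1 ⊕ S Y_0,      *)
(* and S X_1 ⊕ S Y_0 identified with S (X_1 ⊕ Y_0) by susp_sum.             *)
(* ------------------------------------------------------------------------ *)
Record angulation (n : nat) := Angulation {
  susp :> automorphism;
  angle : forall X, seqn n.+1 X (susp X) -> Prop;
  angle_iso : forall X Y (s : seqn n.+1 X (susp X)) (t : seqn n.+1 Y (susp Y))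
      (phi0 : Hom X Y) (phi : scomps s t),
    is_iso phi0 -> sall_iso phi -> scommutes phi0 phi (amor susp phi0) ->
    angle s -> angle t;
  angle_sum : forall X Y (s : seqn n.+1 X (susp X)) (t : seqn n.+1 Y (susp Y)),
    angle s -> angle t -> angle (spost (ssum s t) (susp_sum susp X Y));
  angle_summand : forall X Y
      (s : seqn n.+1 X (susp X)) (t : seqn n.+1 Y (susp Y)),
    angle (spost (ssum s t) (susp_sum susp X Y)) -> angle s /\ angle t;
  angle_id : forall X, angle (scons (idm X) (szero n));
  angle_first : forall X0 X1 (d : Hom X0 X1),
    exists p : seqn n X1 (susp X0), angle (scons d p);
  angle_rotate : forall X0 X1 (d : Hom X0 X1) (p : seqn n X1 (susp X0)),
    angle (scons d p) <-> angle (srcons p ((-1) ^+ n *: amor susp d));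
  angle_mor : forall X0 X1 Y0 Y1 (d : Hom X0 X1) (p : seqn n X1 (susp X0))
      (e : Hom Y0 Y1) (q : seqn n Y1 (susp Y0))
      (phi0 : Hom X0 Y0) (phi1 : Hom X1 Y1),
    angle (scons d p) -> angle (scons e q) -> phi1 ∘ d = e ∘ phi0 ->
    exists phi : scomps p q, scommutes phi1 phi (amor susp phi0);
  angle_cone : forall X0 X1 Y0 Y1 (d : Hom X0 X1) (p : seqn n X1 (susp X0))
      (e : Hom Y0 Y1) (q : seqn n Y1 (susp Y0))
      (phi0 : Hom X0 Y0) (phi1 : Hom X1 Y1),
    angle (scons d p) -> angle (scons e q) -> phi1 ∘ d = e ∘ phi0 ->
    exists phi : scomps p q, scommutes phi1 phi (amor susp phi0) /\
      angle (scone e phi1 phi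
        (susp_sum susp X1 Y0 ∘ mpair (- amor susp d) (amor susp phi0))
        (susp_sum susp X1 Y0 ∘ in2 (susp X1) (susp Y0)))
}.

Section Angulated.
Variables (n : nat) (S : angulation n).

Definition cluster_tilting (T : C) : Prop :=
  (forall f : Hom T (S T), f = 0) /\
  (forall X, exists T0 (q : seqn n T0 X) (h : Hom X (S T0)),
     [/\ angle (srcons q h), addob T T0 & smid_all (addob T) q]).

Variable T : C.

Definition rel_rigid X : Prop := ideal0 (S T) X (S X).

Definition max_rel_rigid X : Prop :=
  rel_rigid X /\
  forall M, ideal0 (S T) (X ⊕ M) (S (X ⊕ M)) -> addob X M.

Definition self_perpendicular X : Prop :=
  forall M, addob X M <-> ideal0 (S T) X (S M) /\ ideal0 (S T) M (S X).

(* M = M0 ⊕ S TM with S TM maximal, for the relation of being a direct      *)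
(* summand, among the direct summands of M that lie in add (S T).             *)
Definition max_decomposition (M M0 TM : C) : Prop :=
  [/\ addob T TM, iso M (M0 ⊕ S TM) &
      forall Z, addob (S T) Z -> summand Z M -> summand (S TM) Z ->
        iso Z (S TM)].

End Angulated.
End Category.

Arguments amor {k C} a {X Y}.
Arguments angle {k C n a X}.

(* ------------------------------------------------------------------------ *)
(* MathComp's falgType excludes the zero algebra, which occurs as End(T)    *)
(* when T = 0.                                                              *)
(* ------------------------------------------------------------------------ *)
Record fdalg (k : fieldType) := FdAlg {
  alg_car :> vectType k;
  amul : alg_car -> alg_car -> alg_car;
  aone : alg_car;
  amulA : associative amul;
  amul1l : left_id aone amul;
  amul1r : right_id aone amul;
  amul_linl : forall b, linear (fun a => amul a b);
  amul_linr : forall a, linear (fun b => amul a b)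
}.

Record rmod (k : fieldType) (L : fdalg k) := RMod {
  mod_car :> vectType k;
  act : mod_car -> L -> mod_car;
  actA : forall m a b, act (act m a) b = act m (amul a b);
  act1 : forall m, act m (aone L) = m;
  act_linl : forall a, linear (fun m => act m a);
  act_linr : forall m, linear (fun a => act m a)
}.

Lemma linfunE (k : fieldType) (U V : vectType k) (f : U -> V) (fl : linear f) u :
  linfun f u = f u.
Proof.
pose g : {linear U -> V} := HB.pack f (GRing.isLinear.Build k U V *:%R f fl).
exact: (lfunE g).
Qed.

Section Modules.
Variables (k : fieldType) (L : fdalg k).
Implicit Types M N P Q : rmod L.

Definition is_mhom M N (f : 'Hom(M, N)) : Prop :=
  forall m a, f (act m a) = act (f m) a.

Definition actf M (a : L) : 'End(M) := linfun (fun m : M => act m a).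

Definition actv M (m : M) : 'Hom(L, M) := linfun (act m).

Lemma actvE M (m : M) a : actv m a = act m a.
Proof. exact: (linfunE (act_linr m)). Qed.

Lemma actfE M a m : actf M a m = act m a.
Proof. exact: (linfunE (act_linl a)). Qed.

Definition mhom_defect M N (a : L) (f : 'Hom(M, N)) : 'Hom(M, N) :=
  (f \o actf M a)%VF - (actf N a \o f)%VF.

Lemma mhom_defect_lin M N a : linear (@mhom_defect M N a).
Proof.
move=> c f g; apply/lfunP=> m; rewrite /mhom_defect.
rewrite !(lfunE, comp_lfunE, actfE) /=.
rewrite !(comp_lfunE, scale_lfunE, add_lfunE, opp_lfunE, actfE).
rewrite (act_linl a c (f m) (g m)) scalerBr opprD.
by rewrite !addrA; congr (_ + _); rewrite addrAC.
Qed.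

(* Hom_L(M, N) as a subspace of Hom_k(M, N); see mhomP. *)
Definition mhom M N : {vspace 'Hom(M, N)} :=
  (\bigcap_(i < \dim {: L})
    lker (linfun (@mhom_defect M N (vbasis {: L})`_i)))%VS.

Lemma mhomP M N (f : 'Hom(M, N)) : f \in mhom M N <-> is_mhom f.
Proof.
have defectE a : (f \in lker (linfun (@mhom_defect M N a))) =
    (mhom_defect a f == 0).
  by rewrite memv_ker (linfunE (mhom_defect_lin a)).
have defect0 a : mhom_defect a f = 0 <-> forall m, f (act m a) = act (f m) a.
  rewrite /mhom_defect; split=> [/lfunP E m|E].
    move: (E m); rewrite add_lfunE opp_lfunE !comp_lfunE !actfE zero_lfunE.
    by move/eqP; rewrite subr_eq0 => /eqP.
  apply/lfunP=> m; rewrite add_lfunE opp_lfunE !comp_lfunE !actfE zero_lfunE.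
  by rewrite E subrr.
split=> [fH m a|fH].
  have fb i : (i < \dim {: L})%N ->
      f (act m (vbasis {: L})`_i) = act (f m) (vbasis {: L})`_i.
    move=> ilt; apply: (proj1 (defect0 _)); apply/eqP; rewrite -defectE.
    have /subv_bigcapP /(_ (Ordinal ilt) isT) : (<[f]> <= mhom M N)%VS by [].
    by [].
  rewrite (coord_vbasis (memvf a)) -!actvE !linear_sum /=.
  by apply: eq_bigr => i _; rewrite !linearZ /= !actvE fb.
suff: (<[f]> <= mhom M N)%VS by [].
apply/subv_bigcapP => i _; rewrite -memvE defectE; apply/eqP/defect0 => m.
exact: fH.
Qed.

Definition mod_iso M N : Prop :=
  exists f : 'Hom(M, N), f \in mhom M N /\ bijective f.

Definition projective P : Prop :=
  forall M N (g : 'Hom(M, N)) (f : 'Hom(P, N)),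
    g \in mhom M N -> limg g = fullv -> f \in mhom P N ->
    exists2 h : 'Hom(P, M), h \in mhom P M & (g \o h)%VF = f.

Definition submodule M (U : {vspace M}) : Prop :=
  forall m a, m \in U -> act m a \in U.

Definition superfluous M (U : {vspace M}) : Prop :=
  forall V : {vspace M}, submodule V -> (U + V)%VS = fullv -> V = fullv.

Section DirectSum.
Variables M N : rmod L.
Let act_sum (x : M * N) (a : L) : M * N := (act x.1 a, act x.2 a).
Fact act_sumA m a b : act_sum (act_sum m a) b = act_sum m (amul a b).
Proof. by rewrite /act_sum /= !actA. Qed.
Fact act_sum1 m : act_sum m (aone L) = m.
Proof. by case: m => m1 m2; rewrite /act_sum /= !act1. Qed.
Fact act_sum_linl a : linear (fun m => act_sum m a).
Proof.
by move=> c x y; congr (_, _); [exact: (act_linl a c) | exact: (act_linl a c)].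
Qed.
Fact act_sum_linr m : linear (fun a => act_sum m a).
Proof. by move=> c x y; congr (_, _); exact: act_linr. Qed.
Definition rsum : rmod L := RMod act_sumA act_sum1 act_sum_linl act_sum_linr.
End DirectSum.

Section Power.
Variables (M : rmod L) (r : nat).
Let act_pow (x : {ffun 'I_r -> M}) (a : L) : {ffun 'I_r -> M} :=
  [ffun i => act (x i) a].
Fact act_powA m a b : act_pow (act_pow m a) b = act_pow m (amul a b).
Proof. by apply/ffunP=> i; rewrite !ffunE actA. Qed.
Fact act_pow1 m : act_pow m (aone L) = m.
Proof. by apply/ffunP=> i; rewrite !ffunE act1. Qed.
Fact act_pow_linl a : linear (fun m => act_pow m a).
Proof.
by move=> c x y; apply/ffunP=> i; rewrite !ffunE; exact: (act_linl a c).
Qed.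
Fact act_pow_linr m : linear (fun a => act_pow m a).
Proof.
by move=> c x y; apply/ffunP=> i; rewrite !ffunE; exact: (act_linr _ c).
Qed.
Definition rpow : rmod L := RMod act_powA act_pow1 act_pow_linl act_pow_linr.
End Power.

(* N is in add M *)
Definition addmod M N : Prop := exists r N', mod_iso (rsum N N') (rpow M r).

Section Submodule.
Variables (M : rmod L) (U : {vspace M}).
Hypothesis US : submodule U.
Let act_sub (u : subvs_of U) (a : L) : subvs_of U :=
  vsproj U (act (vsval u) a).
Let act_subE u a : vsval (act_sub u a) = act (vsval u) a.
Proof. by rewrite vsprojK //; apply: US; exact: subvsP. Qed.
Fact act_subA m a b : act_sub (act_sub m a) b = act_sub m (amul a b).
Proof. by apply: val_inj; rewrite /= !act_subE actA. Qed.
Fact act_sub1 m : act_sub m (aone L) = m.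
Proof. by apply: val_inj; rewrite /= !act_subE act1. Qed.
Fact act_sub_linl a : linear (fun m => act_sub m a).
Proof.
move=> c x y; apply: val_inj; rewrite /= !act_subE; exact: (act_linl a c).
Qed.
Fact act_sub_linr m : linear (fun a => act_sub m a).
Proof.
move=> c x y; apply: val_inj; rewrite /= !act_subE; exact: act_linr.
Qed.
Definition rsub : rmod L := RMod act_subA act_sub1 act_sub_linl act_sub_linr.
End Submodule.

Lemma lker_submodule M N (f : 'Hom(M, N)) :
  f \in mhom M N -> submodule (lker f).
Proof.
move=> /mhomP fH m a; rewrite !memv_ker fH => /eqP ->.
by rewrite -actfE linear0.
Qed.

Definition kermod M N (f : 'Hom(M, N)) (fH : f \in mhom M N) : rmod L :=
  rsub (lker_submodule fH).

Definition regm : rmod L :=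
  @RMod k L L (@amul k L) (fun a b c => esym (amulA a b c))
    (@amul1r k L) (@amul_linl k L) (@amul_linr k L).

(* ------------------------------------------------------------------------ *)
(* The Nakayama functor nu P = Hom_k(Hom_L(P, L), k).  The algebra L acts   *)
(* on Hom_L(P, L) from the left by (a f)(p) = a (f p), and on nu P from the *)
(* right by (xi a)(f) = xi (a f).                                           *)
(* ------------------------------------------------------------------------ *)
Definition lmulf (a : L) : 'End(regm) := linfun (fun b : regm => amul a b).

Lemma lmulfE a b : lmulf a b = amul a b.
Proof. exact: (linfunE (amul_linr a)). Qed.

Definition homL P : vectType k := subvs_of (mhom P regm).

Definition lact P (a : L) (f : homL P) : homL P :=
  vsproj (mhom P regm) (lmulf a \o vsval f)%VF.

Lemma lactE P a (f : homL P) p : vsval (lact a f) p = amul a (vsval f p).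
Proof.
rewrite vsprojK ?comp_lfunE ?lmulfE //; apply/mhomP => q b.
rewrite !comp_lfunE !lmulfE; have /mhomP -> := subvsP f.
exact: amulA.
Qed.

Lemma lact_linr P a : linear (@lact P a).
Proof.
move=> c f g; apply/val_inj/lfunP => p.
by rewrite /= !(lactE, add_lfunE, scale_lfunE) (amul_linr a).
Qed.

Lemma lact_linl P (f : homL P) : linear (fun a => lact a f).
Proof.
move=> c a b; apply/val_inj/lfunP => p.
by rewrite /= !(lactE, add_lfunE, scale_lfunE) (amul_linl _ c).
Qed.

Section Nakayama.
Variable P : rmod L.
Let act_nu (xi : 'Hom(homL P, k^o)) (a : L) : 'Hom(homL P, k^o) :=
  (xi \o linfun (@lact P a))%VF.
Let act_nuE xi a f : act_nu xi a f = xi (lact a f).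
Proof. by rewrite comp_lfunE (linfunE (@lact_linr P a)). Qed.
Fact act_nuA xi a b : act_nu (act_nu xi a) b = act_nu xi (amul a b).
Proof.
apply/lfunP => f; rewrite !act_nuE; congr (xi _).
by apply/val_inj/lfunP => p; rewrite /= !lactE amulA.
Qed.
Fact act_nu1 xi : act_nu xi (aone L) = xi.
Proof.
apply/lfunP => f; rewrite !act_nuE; congr (xi _).
by apply/val_inj/lfunP => p; rewrite /= !lactE amul1l.
Qed.
Fact act_nu_linl a : linear (fun xi => act_nu xi a).
Proof.
by move=> c x y; apply/lfunP => f; rewrite !(act_nuE, add_lfunE, scale_lfunE).
Qed.
Fact act_nu_linr xi : linear (fun a => act_nu xi a).
Proof.
move=> c a b; apply/lfunP => f; rewrite !(act_nuE, add_lfunE, scale_lfunE).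
by rewrite lact_linl linearP.
Qed.
Definition nu : rmod L := RMod act_nuA act_nu1 act_nu_linl act_nu_linr.
End Nakayama.

(* d^* : Hom_L(Q, L) -> Hom_L(P, L), g |-> g \o d *)
Definition homL_map P Q (d : 'Hom(P, Q)) (g : homL Q) : homL P :=
  vsproj (mhom P regm) (vsval g \o d)%VF.

(* nu d : nu P -> nu Q, xi |-> xi \o d^* *)
Definition nu_map P Q (d : 'Hom(P, Q)) : 'Hom(nu P, nu Q) :=
  linfun (fun xi : 'Hom(homL P, k^o) => (xi \o linfun (homL_map d))%VF).

Section NakayamaMap.
Variables (P Q : rmod L) (d : 'Hom(P, Q)).
Hypothesis dH : d \in mhom P Q.

Lemma homL_mapE (g : homL Q) p : vsval (homL_map d g) p = vsval g (d p).
Proof.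
rewrite vsprojK ?comp_lfunE //; apply/mhomP => q b; rewrite !comp_lfunE.
move/mhomP: dH => ->; have /mhomP -> := subvsP g; by [].
Qed.

Lemma homL_map_lin : linear (homL_map d).
Proof.
move=> c f g; apply/val_inj/lfunP => p.
by rewrite /= !(homL_mapE, add_lfunE, scale_lfunE).
Qed.

Lemma nu_mapE (xi : nu P) (g : homL Q) :
  (nu_map d xi : 'Hom(homL Q, k^o)) g =
  (xi : 'Hom(homL P, k^o)) (homL_map d g).
Proof.
rewrite /nu_map linfunE => [|c x y].
  by rewrite comp_lfunE (linfunE homL_map_lin).
by apply/lfunP => f; rewrite !(comp_lfunE, add_lfunE, scale_lfunE).
Qed.

Lemma nu_map_mhom : nu_map d \in mhom (nu P) (nu Q).
Proof.
apply/mhomP => xi a; apply/lfunP => g; rewrite nu_mapE.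
rewrite /act /= !comp_lfunE !(linfunE (@lact_linr _ _)) nu_mapE.
congr (xi _); apply/val_inj/lfunP => p.
by rewrite /= !(lactE, homL_mapE).
Qed.
End NakayamaMap.

(* Minimal projective resolutions ... -> P_1 -> P_0 -> M -> 0: each P_i is a *)
(* projective cover of its image.                                           *)
Record minres M := MinRes {
  res : nat -> rmod L;
  res_d : forall i, 'Hom(res i.+1, res i);
  res_aug : 'Hom(res 0, M);
  res_proj : forall i, projective (res i);
  res_d_mhom : forall i, res_d i \in mhom (res i.+1) (res i);
  res_aug_mhom : res_aug \in mhom (res 0) M;
  res_aug_surj : limg res_aug = fullv;
  res_exact0 : limg (res_d 0) = lker res_aug;
  res_exact : forall i, limg (res_d i.+1) = lker (res_d i);
  res_min0 : superfluous (lker res_aug);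
  res_min : forall i, superfluous (lker (res_d i))
}.

(* tau_n M = Ker (nu P_n -> nu P_(n-1)) for some choice of minimal projective *)
(* resolution; meaningful for n > 0 only.  Such a resolution exists and is   *)
(* unique up to isomorphism, so the choice is immaterial.                    *)
Definition tau (n : nat) M : rmod L :=
  epsilon (inhabits M) (fun X =>
    exists R : minres M, X = kermod (nu_map_mhom (res_d_mhom R n.-1))).

End Modules.

Section FunctorT.
Variables (k : fieldType) (C : lincat k) (T : C).

(* The product a b of End(T) is a ∘ b, so that C(T, X) is a right module     *)
(* under precomposition.                                                    *)
Definition endalg : fdalg k :=
  @FdAlg k (Hom T T) (@comp k C T T T) (idm T)
    (fun a b c => compA a b c) (@comp1m k C T T) (@compm1 k C T T)
    (@comp_linl k C T T T) (@comp_linr k C T T T).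

Definition homT (X : C) : rmod endalg :=
  @RMod k endalg (Hom T X) (fun f a => f ∘ a)
    (fun f a b => esym (compA f a b)) (@compm1 k C T X)
    (@comp_linl k C T T X) (@comp_linr k C T T X).

(* D is the essential image of C(T, -). *)
Definition inD (M : rmod endalg) : Prop := exists X, mod_iso (homT X) M.

Local Notation mods := (rmod endalg).

Definition mod_pair : Type := (mods * mods)%type.

Definition pair_iso (p q : mod_pair) : Prop :=
  mod_iso p.1 q.1 /\ mod_iso p.2 q.2.

Definition is_pair (p : mod_pair) : Prop := inD p.1 /\ projective p.2.

Definition Hom0 (M N : mods) : Prop := mhom M N = 0%VS.

Variable n : nat.

Definition tau_rigid (M : mods) : Prop := Hom0 M (tau n M).

Definition tau_rigid_pair (p : mod_pair) : Prop :=
  [/\ is_pair p, tau_rigid p.1 & Hom0 p.2 p.1].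

Definition max_tau_rigid_pair (p : mod_pair) : Prop :=
  [/\ is_pair p,
      forall N, inD N ->
        (addmod p.1 N <->
         [/\ Hom0 p.1 (tau n N), Hom0 N (tau n p.1) & Hom0 p.2 N]) &
      forall Q, projective Q -> (addmod p.2 Q <-> Hom0 Q p.1)].

Definition support_tau_tilting_pair (p : mod_pair) : Prop :=
  [/\ tau_rigid_pair p,
      forall N, inD N -> tau_rigid_pair (rsum p.1 N, p.2) -> addmod p.1 N &
      forall Q, projective Q -> (addmod p.2 Q <-> Hom0 Q p.1)].

(* M |-> (C(T, M0), C(T, TM)) for M = M0 ⊕ S TM, up to isomorphism of pairs *)
Definition pair_of (S : angulation C n) (M : C) (p : mod_pair) : Prop :=
  exists M0 TM, max_decomposition S T M M0 TM /\ pair_iso (homT M0, homT TM) p.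

End FunctorT.

(* The relation R induces a bijection from the classes for eA of the        *)
(* elements satisfying PA to the classes for eB of the elements satisfying  *)
(* PB.                                                                      *)
Definition class_bijection (A B : Type) (PA : A -> Prop) (eA : A -> A -> Prop)
    (PB : B -> Prop) (eB : B -> B -> Prop) (R : A -> B -> Prop) : Prop :=
  [/\ forall a, PA a -> exists b, R a b,
      forall a b, PA a -> R a b -> PB b,
      forall a a' b b', PA a -> PA a' -> R a b -> R a' b' ->
        (eA a a' <-> eB b b') &
      forall b, PB b -> exists2 a, PA a & R a b].

(* Main.v *)
From mathcomp Require Import all_boot all_algebra.
From Stdlib Require Import ClassicalEpsilon.
Require Import Defs.

Set Implicit Arguments.
Unset Strict Implicit.
Unset Printing Implicit Defensive.

(** Write [F = C(T, -)], and [rel0 X Y] for the vanishing of the maps [X -> S Y]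
    that factor through [add (S T)].  The theorem rests on one equivalence
    ([rel0_tau]): if no nonzero direct summand of [X] lies in [add (S T)], then
    [rel0 X Y] holds if and only if [Hom(F Y, tau_n (F X)) = 0].

    Both sides are lifting conditions.  Take an angle
    [T_0 -> T_1 -> ... -> T_n -> X -> S T_0] with all [T_i] in [add T].  Since
    [C(T, S T) = 0], every map [X -> S T] factors through [X -> S T_0], and
    exactness of [C(-, S Y)] at [S T_0] turns [rel0 X Y] into: every map
    [T_0 -> Y] factors through [T_0 -> T_1] ([rel0_factor]).  On the other side,
    [Hom(N, nu P)] is the dual of [Hom(P, N)] for projective [P]; so, for a
    minimal projective resolution [P_i] of [M], [Hom(N, tau_n M) = 0] means that
    every map [P_n -> N] factors through [P_n -> P_(n-1)] ([hom_ker_nu],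
    [hom_tau]).  Now [F T_0 -> ... -> F T_n] is also the beginning of a projective
    resolution of [F X].  Comparing the two degree by degree
    ([comparison_step]) shows that the second condition follows from the first.
    For the converse the comparison in degree [n] leaves an endomorphism [h] of
    [T_0] that is annihilated by [T_0 -> T_1]; then [S h] factors through [X], and
    as [X] and [S T_0] have no common nonzero summand, Fitting's lemma makes
    [1 + h] invertible ([disjoint_unit]), which is what the lifting needs.

    Next, [F] is full, and its kernel consists of the maps through [add (S T)]
    ([F_full], [F_kernel]).  By the same use of Fitting's lemma, [F] reflects
    isomorphisms between objects without summands in [add (S T)], and it
    identifies [add T] with the projective modules ([projective_F]).

    Finally, write [M = M0 + S A] with [A] in [add T] and [M0] without summands in
    [add (S T)].  The condition [rel0] is additive in both arguments,
    [rel0 X (S A)] always holds, and [rel0 (S A) Y] means [Hom(F A, F Y) = 0].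
    So every condition on [M] in the theorem splits into a condition on [F M0]
    and one on [F A], and these are the conditions on pairs
    ([rel_rigid_pair], [max_rel_rigid_pair], [self_perpendicular_pair]).  The
    pair determines [M] up to isomorphism, and every pair arises
    ([pair_class_bijection]). *)

Import GRing.Theory.
Local Open Scope ring_scope.

(** * Composition, biproducts and additive closures *)

Section Additive.
Variables (k : fieldType) (C : lincat k).
Implicit Types X Y Z W : C.

Lemma compDr X Y Z (g : Hom Y Z) (f f' : Hom X Y) :
  g ∘ (f + f') = g ∘ f + g ∘ f'.
Proof. by have := comp_linr g 1 f f'; rewrite !scale1r. Qed.

Lemma compDl X Y Z (g g' : Hom Y Z) (f : Hom X Y) :
  (g + g') ∘ f = g ∘ f + g' ∘ f.
Proof. by have := comp_linl f 1 g g'; rewrite !scale1r. Qed.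

Lemma compm0 X Y Z (g : Hom Y Z) : g ∘ (0 : Hom X Y) = 0.
Proof. by apply: (addrI (g ∘ 0)); rewrite -compDr !addr0. Qed.

Lemma comp0m X Y Z (f : Hom X Y) : (0 : Hom Y Z) ∘ f = 0.
Proof. by apply: (addrI (0 ∘ f)); rewrite -compDl !addr0. Qed.

Lemma compZr X Y Z c (g : Hom Y Z) (f : Hom X Y) : g ∘ (c *: f) = c *: (g ∘ f).
Proof. by have := comp_linr g c f 0; rewrite compm0 !addr0. Qed.

Lemma compZl X Y Z c (g : Hom Y Z) (f : Hom X Y) : (c *: g) ∘ f = c *: (g ∘ f).
Proof. by have := comp_linl f c g 0; rewrite comp0m !addr0. Qed.

Lemma compNr X Y Z (g : Hom Y Z) (f : Hom X Y) : g ∘ (- f) = - (g ∘ f).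
Proof. by rewrite -[- f]scaleN1r compZr scaleN1r. Qed.

Lemma compNl X Y Z (g : Hom Y Z) (f : Hom X Y) : (- g) ∘ f = - (g ∘ f).
Proof. by rewrite -[- g]scaleN1r compZl scaleN1r. Qed.

Lemma compBr X Y Z (g : Hom Y Z) (f f' : Hom X Y) :
  g ∘ (f - f') = g ∘ f - g ∘ f'.
Proof. by rewrite compDr compNr. Qed.

Lemma compBl X Y Z (g g' : Hom Y Z) (f : Hom X Y) :
  (g - g') ∘ f = g ∘ f - g' ∘ f.
Proof. by rewrite compDl compNl. Qed.

Lemma comp_sumr X Y Z (I : Type) (r : seq I) (g : Hom Y Z) (f : I -> Hom X Y) :
  g ∘ (\sum_(i <- r) f i) = \sum_(i <- r) (g ∘ f i).
Proof. exact: (big_morph _ (compDr g) (compm0 X g)). Qed.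

Lemma comp_suml X Y Z (I : Type) (r : seq I) (g : I -> Hom Y Z) (f : Hom X Y) :
  (\sum_(i <- r) g i) ∘ f = \sum_(i <- r) (g i ∘ f).
Proof.
exact: (big_morph (fun g => g ∘ f) (fun g g' => compDl g g' f) (comp0m Z f)).
Qed.

Lemma mcopair_mpair X Y Z W (f : Hom X Z) (g : Hom Y Z) (a : Hom W X) b :
  mcopair f g ∘ mpair a b = f ∘ a + g ∘ b.
Proof.
rewrite /mcopair /mpair !compDl !compDr -!compA.
rewrite !(compA (pr1 _ _)) !(compA (pr2 _ _)).
by rewrite pr1_in1 pr2_in2 pr1_in2 pr2_in1 !comp1m !comp0m !compm0 addr0 add0r.
Qed.

Lemma pr1_mpair X Y Z (f : Hom X Y) (g : Hom X Z) : pr1 Y Z ∘ mpair f g = f.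
Proof.
by rewrite /mpair compDr !compA pr1_in1 pr1_in2 comp1m comp0m addr0.
Qed.

Lemma pr2_mpair X Y Z (f : Hom X Y) (g : Hom X Z) : pr2 Y Z ∘ mpair f g = g.
Proof.
by rewrite /mpair compDr !compA pr2_in1 pr2_in2 comp1m comp0m add0r.
Qed.

Lemma mcopair_in1 X Y Z (f : Hom X Z) (g : Hom Y Z) : mcopair f g ∘ in1 X Y = f.
Proof.
by rewrite /mcopair compDl -!compA pr1_in1 pr2_in1 compm1 compm0 addr0.
Qed.

Lemma mcopair_in2 X Y Z (f : Hom X Z) (g : Hom Y Z) : mcopair f g ∘ in2 X Y = g.
Proof.
by rewrite /mcopair compDl -!compA pr1_in2 pr2_in2 compm1 compm0 add0r.
Qed.

Lemma bip_ext_in X Y Z (f g : Hom (X ⊕ Y) Z) :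
  f ∘ in1 X Y = g ∘ in1 X Y -> f ∘ in2 X Y = g ∘ in2 X Y -> f = g.
Proof.
move=> e1 e2; rewrite -[f]compm1 -[g]compm1 -bip_id !compDr !compA.
by rewrite e1 e2.
Qed.

Lemma bip_ext_pr X Y Z (f g : Hom Z (X ⊕ Y)) :
  pr1 X Y ∘ f = pr1 X Y ∘ g -> pr2 X Y ∘ f = pr2 X Y ∘ g -> f = g.
Proof.
move=> e1 e2; rewrite -[f]comp1m -[g]comp1m -bip_id !compDl -!compA.
by rewrite e1 e2.
Qed.

Lemma bip_decomp X Y A B (r : Hom (X ⊕ Y) B) (s : Hom A (X ⊕ Y)) :
  r ∘ s = (r ∘ in1 X Y) ∘ (pr1 X Y ∘ s) + (r ∘ in2 X Y) ∘ (pr2 X Y ∘ s).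
Proof.
by rewrite -[s in LHS]comp1m -bip_id compDl compDr !compA.
Qed.

Lemma zero_to X Y (f : Hom X Y) : idm Y = 0 -> f = 0.
Proof. by move=> z; rewrite -[f]comp1m z comp0m. Qed.

Lemma zero_from X Y (f : Hom X Y) : idm X = 0 -> f = 0.
Proof. by move=> z; rewrite -[f]compm1 z compm0. Qed.

Definition retract X Y : Prop :=
  exists (s : Hom X Y) (r : Hom Y X), r ∘ s = idm X.

Lemma retract_trans Y X Z : retract X Y -> retract Y Z -> retract X Z.
Proof.
move=> [s [r rs]] [s' [r' rs']]; exists (s' ∘ s), (r ∘ r').
by rewrite -compA (compA r') rs' comp1m.
Qed.

Lemma retract_in1 X Y : retract X (X ⊕ Y).
Proof. by exists (in1 X Y), (pr1 X Y); rewrite pr1_in1. Qed.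

Lemma retract_in2 X Y : retract Y (X ⊕ Y).
Proof. by exists (in2 X Y), (pr2 X Y); rewrite pr2_in2. Qed.

Lemma iso_refl X : iso X X.
Proof. by exists (idm X), (idm X); rewrite comp1m. Qed.

Lemma iso_sym X Y : iso X Y -> iso Y X.
Proof. by move=> [f [g [gf fg]]]; exists g, f. Qed.

Lemma iso_trans Y X Z : iso X Y -> iso Y Z -> iso X Z.
Proof.
move=> [f [g [gf fg]]] [f' [g' [gf' fg']]]; exists (f' ∘ f), (g ∘ g').
by split; rewrite -compA; [rewrite (compA g') gf' | rewrite (compA f) fg];
  rewrite comp1m.
Qed.

Lemma iso_retract X Y : iso X Y -> retract X Y.
Proof. by move=> [f [g [gf _]]]; exists f, g. Qed.

Lemma retract_zero X Y : idm X = 0 -> retract X Y.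
Proof. by move=> X0; exists 0, 0; rewrite comp0m X0. Qed.

Lemma zero_retract X Y : retract X Y -> idm Y = 0 -> idm X = 0.
Proof. by move=> [s [r <-]] Y0; apply: etrans (compm0 _ r); rewrite (zero_to s Y0). Qed.

Lemma zero_iso X Y : idm X = 0 -> idm Y = 0 -> iso X Y.
Proof. by move=> X0 Y0; exists 0, 0; rewrite !comp0m X0 Y0. Qed.

Lemma iso_bip X Y X' Y' : iso X X' -> iso Y Y' -> iso (X ⊕ Y) (X' ⊕ Y').
Proof.
move=> [f [f' [ff ff']]] [g [g' [gg gg']]].
exists (mcopair (in1 X' Y' ∘ f) (in2 X' Y' ∘ g)).
exists (mcopair (in1 X Y ∘ f') (in2 X Y ∘ g')).
split; apply: bip_ext_in;
by rewrite -compA ?mcopair_in1 ?mcopair_in2 compA ?mcopair_in1 ?mcopair_in2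
  -compA ?(ff, ff', gg, gg') compm1 comp1m.
Qed.

Lemma split_retract (split : split_idempotents C) X Y (s : Hom X Y) (r : Hom Y X) :
  r ∘ s = idm X -> exists Y' (s' : Hom Y' Y) (r' : Hom Y Y'),
    [/\ s ∘ r + s' ∘ r' = idm Y, r' ∘ s' = idm Y', r ∘ s' = 0 & r' ∘ s = 0].
Proof.
move=> rs; pose e := idm Y - s ∘ r.
have se : e ∘ s = 0 by rewrite compBl comp1m -compA rs compm1 subrr.
have re : r ∘ e = 0 by rewrite compBr compm1 compA rs comp1m subrr.
have ee : e ∘ e = e by rewrite {1}/e compBl comp1m -compA re compm0 subr0.
have [Y' [r' [s' [sr' rs']]]] := split _ e ee.
exists Y', s', r'; split=> //; first by rewrite sr' addrC subrK.
  by rewrite -[s']compm1 -rs' (compA s') sr' compA re comp0m.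
by rewrite -[r']comp1m -rs' -(compA r') sr' -compA se compm0.
Qed.

Lemma retract_summand (split : split_idempotents C) X Y : retract X Y -> summand X Y.
Proof.
move=> [s [r rs]]; have [Y' [s' [r' [e rs' r0 r0']]]] := split_retract split rs.
exists Y', (mcopair s s'), (mpair r r'); split; last by rewrite mcopair_mpair.
apply: bip_ext_in; rewrite -compA ?mcopair_in1 ?mcopair_in2 comp1m;
by rewrite compDl -!compA ?rs ?rs' ?r0 ?r0' compm0 ?compm1 ?add0r ?addr0.
Qed.

Lemma summand_retract X Y : summand X Y -> retract X Y.
Proof. by move=> [Z /iso_retract]; apply: retract_trans (retract_in1 _ _). Qed.

(** Membership in [add M] is tested by [idsum]: finite lists of maps need no
    choice of a complement, and functors transport them. *)
Definition sum_through M X Y (f : Hom X Y) : Prop :=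
  exists l : seq (Hom M Y * Hom X M), f = \sum_(x <- l) x.1 ∘ x.2.

Definition idsum M X : Prop := sum_through M (idm X).

Lemma sum_through1 M X Y (g : Hom M Y) (f : Hom X M) : sum_through M (g ∘ f).
Proof. by exists [:: (g, f)]; rewrite big_seq1. Qed.

Lemma sum_throughD M X Y (f g : Hom X Y) :
  sum_through M f -> sum_through M g -> sum_through M (f + g).
Proof. by move=> [l ->] [l' ->]; exists (l ++ l'); rewrite big_cat. Qed.

Lemma sum_through_comp M X Y X' Y' (f : Hom X Y) (g : Hom Y Y') (h : Hom X' X) :
  sum_through M f -> sum_through M (g ∘ f ∘ h).
Proof.
move=> [l ->]; exists [seq (g ∘ x.1, x.2 ∘ h) | x <- l].
rewrite big_map comp_sumr comp_suml; apply: eq_bigr => x _ /=.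
by rewrite !compA.
Qed.

Lemma sum_through0 M X Y : sum_through M (0 : Hom X Y).
Proof. by exists [::]; rewrite big_nil. Qed.

Lemma idsum_refl M : idsum M M.
Proof. by rewrite /idsum -(comp1m (idm M)); apply: sum_through1. Qed.

Lemma idsum_retract M X Y : retract X Y -> idsum M Y -> idsum M X.
Proof.
by move=> [s [r rs]] /(sum_through_comp r s); rewrite compm1 rs.
Qed.

Lemma idsum_bip M X Y : idsum M X -> idsum M Y -> idsum M (X ⊕ Y).
Proof.
move=> hX hY; rewrite /idsum -bip_id -[in1 _ _]compm1 -[in2 _ _]compm1.
by apply: sum_throughD; apply: sum_through_comp.
Qed.

Lemma idsum_trans Y X Z : idsum X Y -> idsum Y Z -> idsum X Z.
Proof.
move=> hX [l e]; rewrite /idsum e; elim: l {e} => [|x l IH].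
  by rewrite big_nil; apply: sum_through0.
rewrite big_cons; apply: sum_throughD IH.
by rewrite -[x.1]compm1; apply: sum_through_comp.
Qed.

Lemma idsum_cpow M m : idsum M (cpow M m).
Proof.
elim: m => [|m IH] /=; last exact: idsum_bip (idsum_refl M) IH.
by rewrite /idsum zobP; apply: sum_through0.
Qed.

Lemma sum_through_cpow M X Y (f : Hom X Y) : sum_through M f ->
  exists m (g : Hom (cpow M m) Y) (h : Hom X (cpow M m)), f = g ∘ h.
Proof.
move=> [l ->]; elim: l => [|x l [m [g [h e]]]].
  by exists 0%N, 0, 0; rewrite big_nil comp0m.
by exists m.+1, (mcopair x.1 g), (mpair x.2 h); rewrite big_cons e mcopair_mpair.
Qed.

Lemma addob_idsum M X : addob M X -> idsum M X.
Proof. by move=> [m /summand_retract/idsum_retract]; apply; apply: idsum_cpow. Qed.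

Lemma idsum_addob (split : split_idempotents C) M X : idsum M X -> addob M X.
Proof.
move=> /sum_through_cpow [m [g [h e]]]; exists m; apply: retract_summand => //.
by exists h, g.
Qed.

(** The ideal of maps through [add Z] consists of the finite sums of maps
    through [Z], so its vanishing can be tested on composites [X -> Z -> Y]. *)
Lemma ideal0P (split : split_idempotents C) Z X Y :
  ideal0 Z X Y <-> forall (h : Hom X Z) (g : Hom Z Y), g ∘ h = 0.
Proof.
split=> [H h g|H f [W [/addob_idsum [l e] [g [h ->]]]]].
  apply: H; exists Z; split; last by exists g, h.
  by apply: idsum_addob => //; apply: idsum_refl.
rewrite -[g]compm1 e comp_sumr comp_suml big1 // => x _.
by rewrite compA -compA H.
Qed.

Lemma inverse_unique X Y (f : Hom X Y) g g' : g ∘ f = idm X -> f ∘ g' = idm Y -> g = g'.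
Proof. by move=> e e'; rewrite -[g]compm1 -e' compA e comp1m. Qed.

End Additive.

(** * Fitting decompositions and disjoint objects *)

Lemma ex_minimizer (A : Type) (P : A -> Prop) (f : A -> nat) :
  (exists a, P a) -> exists2 a, P a & forall b, P b -> (f a <= f b)%N.
Proof.
suff H d a : P a -> (f a < d)%N -> exists2 a, P a & forall b, P b -> (f a <= f b)%N.
  by move=> [a Pa]; apply: H Pa (ltnSn _).
elim: d a => // d IH a Pa; rewrite ltnS => le_d.
case: (classic (exists b, P b /\ (f b < f a)%N)) => [[b [Pb lt_ba]]|nb].
  exact: IH Pb (leq_trans lt_ba le_d).
exists a => // b Pb; rewrite leqNgt; apply/negP => lt_ba.
by apply: nb; exists b.
Qed.

Lemma vspace_dcc (k : fieldType) (V : vectType k) (U : nat -> {vspace V}) :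
  (forall i j, (i <= j)%N -> (U j <= U i)%VS) ->
  exists m, forall j, (m <= j)%N -> U j = U m.
Proof.
move=> U_decr; have [|m _ min_m] := @ex_minimizer nat xpredT (fun i => \dim (U i)).
  by exists 0%N.
by exists m => j le_mj; apply/eqP; rewrite eqEdim U_decr // min_m.
Qed.

Section Fitting.
Variables (k : fieldType) (C : lincat k).
Implicit Types X Y Z W : C.

Definition endo_pow X (a : Hom X X) m : Hom X X := iter m (comp a) (idm X).

Lemma endo_powD X (a : Hom X X) i j :
  endo_pow a (i + j) = endo_pow a i ∘ endo_pow a j.
Proof. by elim: i => [|i IH] /=; rewrite ?comp1m // [LHS]/= -compA -IH. Qed.

Lemma endo_pow1 X (a : Hom X X) : endo_pow a 1 = a.
Proof. by rewrite /endo_pow /= compm1. Qed.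

(** The right ideals and the left ideals generated by the powers of [a] are
    descending chains of subspaces of [End X], hence stationary. *)
Lemma endo_pow_absorb X (a : Hom X X) : exists m, forall j, (m <= j)%N ->
  exists u v, endo_pow a m = endo_pow a j ∘ u /\ endo_pow a m = v ∘ endo_pow a j.
Proof.
pose p := endo_pow a.
pose U j := limg (linfun (fun x : Hom X X => p j ∘ x)).
pose V j := limg (linfun (fun x : Hom X X => x ∘ p j)).
have memU j x : x \in U j <-> exists u, x = p j ∘ u.
  split=> [/memv_imgP[u _ ->]|[u ->]].
    by exists u; rewrite (linfunE (comp_linr _)).
  by rewrite -(linfunE (comp_linr _)) memv_img // memvf.
have memV j x : x \in V j <-> exists u, x = u ∘ p j.
  split=> [/memv_imgP[u _ ->]|[u ->]].
    by exists u; rewrite (linfunE (comp_linl _)).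
  by rewrite -(linfunE (comp_linl _)) memv_img // memvf.
have [|m Um] := @vspace_dcc _ _ U.
  move=> i j le_ij; apply/subvP => x /memU [u ->]; apply/memU.
  by exists (p (j - i)%N ∘ u); rewrite compA -endo_powD subnKC.
have [|m' Vm] := @vspace_dcc _ _ V.
  move=> i j le_ij; apply/subvP => x /memV [u ->]; apply/memV.
  by exists (u ∘ p (j - i)%N); rewrite -compA -endo_powD subnK.
exists (maxn m m') => j le_j; have [lem lem'] := (leq_maxl m m', leq_maxr m m').
have [u eu] : exists u, p (maxn m m') = p j ∘ u.
  apply/memU; rewrite (Um _ (leq_trans lem le_j)) -(Um _ lem).
  by apply/memU; exists (idm X); rewrite compm1.
have [v ev] : exists v, p (maxn m m') = v ∘ p j.
  apply/memV; rewrite (Vm _ (leq_trans lem' le_j)) -(Vm _ lem').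
  by apply/memV; exists (idm X); rewrite comp1m.
by exists u, v.
Qed.

(** For such [b], [u], [v] the element [b u = v b] is idempotent, and
    [b = b (b u) = (b u) b]: it projects onto the part of [X] on which [a] is
    invertible. *)
Lemma fitting X (a : Hom X X) : exists m b u v,
  [/\ b = endo_pow a m.+1, b = b ∘ b ∘ u & b = v ∘ b ∘ b].
Proof.
have [m absorb] := endo_pow_absorb a.
have [u [v [eu ev]]] := absorb (m.+1 + m.+1)%N (leq_trans (leqnSn m) (leq_addr _ _)).
pose b := endo_pow a m.+1; exists m, b, (u ∘ a), (a ∘ v).
have ba : b = endo_pow a m ∘ a by rewrite /b -addn1 endo_powD endo_pow1.
have ab : b = a ∘ endo_pow a m by [].
split=> //; first by rewrite {1}ba eu endo_powD !compA.
by rewrite {1}ab ev endo_powD !compA.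
Qed.

(** Disjointness takes the place of decompositions into indecomposable objects: it
    allows cancellation ([disjoint_cancel]), and it is tested on retracts. *)
Definition disjoint X Y : Prop :=
  forall W, retract W X -> retract W Y -> idm W = 0.

Lemma disjoint_sym X Y : disjoint X Y -> disjoint Y X.
Proof. by move=> d W WX WY; apply: d. Qed.

Hypothesis split : split_idempotents C.

(** Fitting's lemma for [a = 1 - g f] yields a complementary idempotent [e]
    that some power of [a] annihilates.  As that power is again of the form
    [1 - g q], the map [e] factors through [Y], and splitting it gives a common
    retract of [X] and [Y]; so [e = 0] and [a] is invertible. *)
Lemma disjoint_unit X Y (f : Hom X Y) (g : Hom Y X) :
  disjoint X Y -> is_iso (idm X - g ∘ f).
Proof.
move=> dXY; pose a := idm X - g ∘ f.
have powq m : exists q : Hom X Y, endo_pow a m = idm X - g ∘ q.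
  elim: m => [|m [q e]]; first by exists 0; rewrite compm0 subr0.
  exists (q + f - f ∘ g ∘ q); rewrite [LHS]/= -/(endo_pow a m) e /a.
  rewrite compBl comp1m !compBr compDr compm1 !compA.
  by rewrite -addrA -opprD addrA.
have [m [b [u [v [b_pow bu vb]]]]] := fitting a.
have comm : b ∘ u = v ∘ b by rewrite {1}vb -!compA (compA b b) -bu.
pose e := idm X - b ∘ u.
have be : b ∘ e = 0 by rewrite compBr compm1 compA -bu subrr.
have ee : e ∘ e = e by rewrite {1}/e compBl comp1m comm -compA be compm0 subr0.
have [W [r [s [sr rs]]]] := split ee.
have [q eq_b] := powq m.+1; rewrite -b_pow in eq_b.
(* b = 1 - g q annihilates e *)
have fac : e = g ∘ (q ∘ e).
  apply/eqP; rewrite -subr_eq0 -be eq_b compBl comp1m compA.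
  by apply/eqP.
have W0 : idm W = 0.
  apply: dXY; first by exists s, r.
  exists (q ∘ e ∘ s), (r ∘ g).
  rewrite -compA (compA g) -fac -sr -compA rs compm1.
  by rewrite rs.
have e0 : e = 0 by rewrite -sr (zero_from s W0) comp0m.
have bu1 : b ∘ u = idm X by apply/eqP; rewrite eq_sym -subr_eq0 -/e e0.
have vb1 : v ∘ b = idm X by rewrite -comm.
exists (v ∘ endo_pow a m); rewrite -/a; split.
  by rewrite -compA -{2}[a]endo_pow1 -endo_powD addn1 -b_pow.
have -> : v ∘ endo_pow a m = endo_pow a m ∘ u.
  apply: (@inverse_unique _ _ _ _ a).
    by rewrite -compA -{2}[a]endo_pow1 -endo_powD addn1 -b_pow.
  by rewrite compA -[_ ∘ endo_pow a m]/(endo_pow a m.+1) -b_pow.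
by rewrite compA -[_ ∘ endo_pow a m]/(endo_pow a m.+1) -b_pow.
Qed.

(** If [r1 s1 + r2 s2 = 1] on [Z] and [r1 s1] factors through [X], then
    [r2 s2 = 1 - r1 s1] is invertible. *)
Lemma disjoint_cancel Z X Y :
  disjoint Z X -> retract Z (X ⊕ Y) -> retract Z Y.
Proof.
move=> d [s [r]]; rewrite bip_decomp => rs.
have [c [ca _]] := disjoint_unit (pr1 X Y ∘ s) (r ∘ in1 X Y) d.
exists (pr2 X Y ∘ s), (c ∘ (r ∘ in2 X Y)).
rewrite -ca -compA; congr (_ ∘ _).
by rewrite -rs addrAC subrr add0r.
Qed.

(** Dimensions of endomorphism algebras measure the size of objects: they grow
    along retracts, and strictly so unless the retract is an isomorphism. *)
Lemma retract_endo_inj X Y (s : Hom X Y) (r : Hom Y X) : r ∘ s = idm X ->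
  exists2 E : 'Hom(Hom X X, Hom Y Y), (forall f, E f = s ∘ f ∘ r) & lker E = 0%VS.
Proof.
move=> rs; pose E := linfun (fun f : Hom X X => s ∘ f ∘ r).
have EE f : E f = s ∘ f ∘ r.
  by apply: linfunE => c g h; rewrite compDr compZr compDl compZl.
exists E => //; apply/eqP/lker0P => f g; rewrite !EE => e.
have := congr1 (fun h => r ∘ h ∘ s) e.
by rewrite !compA rs !comp1m -!compA rs !compm1.
Qed.

Lemma retract_dim X Y : retract X Y -> (\dim {: Hom X X} <= \dim {: Hom Y Y})%N.
Proof.
move=> [s [r /retract_endo_inj [E _ E0]]].
rewrite -(@limg_dim_eq _ _ _ E) ?E0 ?capv0 //.
by apply: dimvS; apply: subvf.
Qed.

Lemma retract_dim_id X Y (s : Hom X Y) (r : Hom Y X) : r ∘ s = idm X ->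
  (\dim {: Hom Y Y} <= \dim {: Hom X X})%N -> s ∘ r = idm Y.
Proof.
move=> rs le_d; have [E EE E0] := retract_endo_inj rs.
have : idm Y \in limg E.
  suff -> : limg E = fullv by rewrite memvf.
  by apply/eqP; rewrite eqEdim subvf /= limg_dim_eq ?E0 ?capv0.
move=> /memv_imgP [f _]; rewrite EE => e.
by rewrite -[LHS]compm1 {1}e !compA -(compA s) rs compm1.
Qed.

Lemma retract_iso X Y : retract X Y ->
  (\dim {: Hom Y Y} <= \dim {: Hom X X})%N -> iso X Y.
Proof. by move=> [s [r rs]] le; exists s, r; split=> //; apply: retract_dim_id. Qed.

Lemma retract_antisym X Y : retract X Y -> retract Y X -> iso X Y.
Proof. by move=> XY /retract_dim; apply: retract_iso. Qed.

Lemma iso_bip_zero X Y : iso (X ⊕ Y) X -> idm Y = 0.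
Proof.
move=> /iso_retract/retract_dim le.
have e := retract_dim_id (pr1_in1 X Y) le.
rewrite -(pr2_in2 X Y) -[in2 _ _]comp1m -e -compA pr1_in2.
by rewrite !compm0.
Qed.

End Fitting.

(** * The category of modules *)

Lemma fun_choice (A B : Type) (R : A -> B -> Prop) :
  (forall x, exists y, R x y) -> exists f, forall x, R x (f x).
Proof.
move=> H; pose f x := constructive_indefinite_description (R x) (H x).
by exists (fun x => proj1_sig (f x)) => x; apply: proj2_sig.
Qed.

Section ModuleCategory.
Variables (k : fieldType) (L : fdalg k).
Implicit Types M N P Q : rmod L.

(** Bundling the module homomorphisms makes the modules a linear category, so that
    retracts, additive closures and idempotents of modules are covered by the
    results on linear categories. *)
Definition mh M N : vectType k := subvs_of (mhom M N).

Lemma mh_act M N (f : mh M N) x a : vsval f (act x a) = act (vsval f x) a.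
Proof. by have /mhomP -> := subvsP f. Qed.

Lemma mh_ext M N (f g : mh M N) : (forall x, vsval f x = vsval g x) -> f = g.
Proof. by move=> e; apply/val_inj/lfunP. Qed.

Lemma mkmh_subproof M N (f : M -> N) : linear f ->
  (forall x a, f (act x a) = act (f x) a) -> linfun f \in mhom M N.
Proof. by move=> fl fa; apply/mhomP => x a; rewrite !(linfunE fl). Qed.

Definition mkmh M N (f : M -> N) : mh M N := vsproj _ (linfun f).

Lemma mkmhE M N (f : M -> N) : linear f ->
  (forall x a, f (act x a) = act (f x) a) -> vsval (mkmh f) =1 f.
Proof. by move=> fl fa x; rewrite vsprojK ?(linfunE fl) //; apply: mkmh_subproof. Qed.

Definition mh_id M : mh M M := mkmh id.
Definition mh_comp M N P (g : mh N P) (f : mh M N) : mh M P :=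
  mkmh (fun x => vsval g (vsval f x)).

Lemma mh_idE M x : vsval (mh_id M) x = x.
Proof. exact: mkmhE. Qed.

Lemma mh_compE M N P (g : mh N P) (f : mh M N) x :
  vsval (mh_comp g f) x = vsval g (vsval f x).
Proof. by apply: mkmhE => [c u v|y a]; rewrite ?linearP // !mh_act. Qed.

Fact mh_compA M N P Q (h : mh P Q) (g : mh N P) (f : mh M N) :
  mh_comp h (mh_comp g f) = mh_comp (mh_comp h g) f.
Proof. by apply: mh_ext => x; rewrite !mh_compE. Qed.

Fact mh_comp1m M N (f : mh M N) : mh_comp (mh_id N) f = f.
Proof. by apply: mh_ext => x; rewrite mh_compE mh_idE. Qed.

Fact mh_compm1 M N (f : mh M N) : mh_comp f (mh_id M) = f.
Proof. by apply: mh_ext => x; rewrite mh_compE mh_idE. Qed.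

Lemma mh_linE M N c (f g : mh M N) x :
  vsval (c *: f + g) x = c *: vsval f x + vsval g x.
Proof. by rewrite linearP /= add_lfunE scale_lfunE. Qed.

Fact mh_comp_linr M N P (g : mh N P) : linear (fun f : mh M N => mh_comp g f).
Proof. by move=> c f f'; apply: mh_ext => x; rewrite !(mh_linE, mh_compE) linearP. Qed.

Fact mh_comp_linl M N P (f : mh M N) : linear (fun g : mh N P => mh_comp g f).
Proof. by move=> c g g'; apply: mh_ext => x; rewrite !(mh_linE, mh_compE). Qed.

Definition zero_mod : rmod L.
Proof.
by refine (@RMod k L 'rV[k]_0 (fun m _ => m) _ _ _ _) => //= m c a b;
  rewrite ?thinmx0 //; apply/rowP => -[].
Defined.

Fact mh_zmod : mh_id zero_mod = 0.
Proof.
by apply: mh_ext => x; have -> : x = 0 by [exact: thinmx0]; rewrite !linear0.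
Qed.

Fact mh_in1_lin M N : linear (fun x : M => (x, 0) : rsum M N).
Proof. by move=> c x y; apply/pair_equal_spec; rewrite /= scaler0 addr0. Qed.
Fact mh_in2_lin M N : linear (fun x : N => (0, x) : rsum M N).
Proof. by move=> c x y; apply/pair_equal_spec; rewrite /= scaler0 addr0. Qed.

Lemma act0m M a : act (0 : M) a = 0.
Proof. by rewrite -actfE linear0. Qed.

Definition mh_in1 M N : mh M (rsum M N) := mkmh (fun x : M => (x, 0) : rsum M N).
Definition mh_in2 M N : mh N (rsum M N) := mkmh (fun x : N => (0, x) : rsum M N).
Definition mh_pr1 M N : mh (rsum M N) M := mkmh (fun x : rsum M N => x.1).
Definition mh_pr2 M N : mh (rsum M N) N := mkmh (fun x : rsum M N => x.2).

Lemma mh_in1E M N x : vsval (mh_in1 M N) x = (x, 0).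
Proof. by apply: mkmhE => [|y a]; [exact: mh_in1_lin | rewrite /act /= act0m]. Qed.
Lemma mh_in2E M N x : vsval (mh_in2 M N) x = (0, x).
Proof. by apply: mkmhE => [|y a]; [exact: mh_in2_lin | rewrite /act /= act0m]. Qed.
Lemma mh_pr1E M N x : vsval (mh_pr1 M N) x = x.1.
Proof. exact: mkmhE. Qed.
Lemma mh_pr2E M N x : vsval (mh_pr2 M N) x = x.2.
Proof. exact: mkmhE. Qed.

Let mhE := (mh_compE, mh_in1E, mh_in2E, mh_pr1E, mh_pr2E, mh_idE).

Fact mh_pr1_in1 M N : mh_comp (mh_pr1 M N) (mh_in1 M N) = mh_id M.
Proof. by apply: mh_ext => x; rewrite !mhE. Qed.
Fact mh_pr2_in2 M N : mh_comp (mh_pr2 M N) (mh_in2 M N) = mh_id N.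
Proof. by apply: mh_ext => x; rewrite !mhE. Qed.
Fact mh_pr1_in2 M N : mh_comp (mh_pr1 M N) (mh_in2 M N) = 0.
Proof. by apply: mh_ext => x; rewrite !mhE zero_lfunE. Qed.
Fact mh_pr2_in1 M N : mh_comp (mh_pr2 M N) (mh_in1 M N) = 0.
Proof. by apply: mh_ext => x; rewrite !mhE zero_lfunE. Qed.
Fact mh_bip_id M N :
  mh_comp (mh_in1 M N) (mh_pr1 M N) + mh_comp (mh_in2 M N) (mh_pr2 M N)
  = mh_id (rsum M N).
Proof.
apply: mh_ext => x; rewrite -[mh_comp (mh_in1 _ _) _]scale1r mh_linE scale1r !mhE.
by case: x => x y; congr (_, _); rewrite ?addr0 ?add0r.
Qed.

Definition modcat : lincat k :=
  @LinCat k (rmod L) mh mh_id mh_comp mh_compA mh_comp1m mh_compm1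
    mh_comp_linr mh_comp_linl zero_mod mh_zmod (@rsum k L) mh_in1 mh_in2 mh_pr1 mh_pr2
    mh_pr1_in1 mh_pr2_in2 mh_pr1_in2 mh_pr2_in1 mh_bip_id.

End ModuleCategory.

Definition mapp (k : fieldType) (L : fdalg k) (M N : modcat L) (f : Hom M N) :
  (M : rmod L) -> (N : rmod L) := vsval (f : mh M N).
Notation "f @@ x" := (mapp f x) (at level 35, right associativity).

Section ModuleMaps.
Variables (k : fieldType) (L : fdalg k).
Local Notation mods := (modcat L).
Implicit Types M N P Q : mods.

Lemma mext M N (f g : Hom M N) : (forall x, f @@ x = g @@ x) -> f = g.
Proof. exact: mh_ext. Qed.

Lemma mappC M N P (g : Hom N P) (f : Hom M N) x : (g ∘ f) @@ x = g @@ f @@ x.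
Proof. exact: mh_compE. Qed.

Lemma mapp1 M x : idm M @@ x = x.
Proof. exact: mh_idE. Qed.

Lemma mappL M N c (f g : Hom M N) x : (c *: f + g) @@ x = c *: (f @@ x) + g @@ x.
Proof. exact: mh_linE. Qed.

Lemma mappD M N (f g : Hom M N) x : (f + g) @@ x = f @@ x + g @@ x.
Proof. by rewrite -{1}[f]scale1r mappL scale1r. Qed.

Lemma mapp0 M N x : (0 : Hom M N) @@ x = 0.
Proof. by rewrite /mapp /= zero_lfunE. Qed.

Lemma mappN M N (f : Hom M N) x : (- f) @@ x = - (f @@ x).
Proof. by apply/eqP; rewrite -addr_eq0 -mappD addNr mapp0. Qed.

Lemma mappB M N (f g : Hom M N) x : (f - g) @@ x = f @@ x - g @@ x.
Proof. by rewrite mappD mappN. Qed.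

Lemma mapp_sum M N (I : Type) (r : seq I) (f : I -> Hom M N) x :
  (\sum_(i <- r) f i) @@ x = \sum_(i <- r) (f i @@ x).
Proof.
elim: r => [|i r IH]; first by rewrite !big_nil mapp0.
by rewrite !big_cons mappD IH.
Qed.

Lemma mlin M N (f : Hom M N) c x y : f @@ (c *: x + y) = c *: (f @@ x) + f @@ y.
Proof. by rewrite /mapp linearP. Qed.

Lemma mlinD M N (f : Hom M N) x y : f @@ (x + y) = f @@ x + f @@ y.
Proof. by rewrite -{1}[x]scale1r mlin scale1r. Qed.

Lemma mlin0 M N (f : Hom M N) : f @@ 0 = 0.
Proof. exact: linear0. Qed.

Lemma mlinB M N (f : Hom M N) x y : f @@ (x - y) = f @@ x - f @@ y.
Proof. exact: linearB. Qed.

Lemma mlin_sum M N (f : Hom M N) (I : Type) (r : seq I) (x : I -> (M : rmod L)) :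
  f @@ (\sum_(i <- r) x i) = \sum_(i <- r) (f @@ x i).
Proof.
elim: r => [|i r IH]; first by rewrite !big_nil mlin0.
by rewrite !big_cons mlinD IH.
Qed.

Lemma mact M N (f : Hom M N) x a : f @@ (act x a) = act (f @@ x) a.
Proof. exact: mh_act. Qed.

Lemma mkmapp (M N : rmod L) (f : M -> N) : linear f ->
  (forall x a, f (act x a) = act (f x) a) ->
  exists g : Hom (M : mods) N, forall x, g @@ x = f x.
Proof. by move=> fl fa; exists (mkmh f : mh M N); apply: mkmhE. Qed.

Definition msurj M N (f : Hom M N) : Prop := forall y, exists x, f @@ x = y.

Lemma msurjP M N (f : Hom M N) : limg (vsval (f : mh M N)) = fullv <-> msurj f.
Proof.
split=> [e y|s].
  have /memv_imgP [x _ ->] : y \in limg (vsval (f : mh M N)) by rewrite e memvf.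
  by exists x.
apply/eqP; rewrite eqEsubv subvf /=; apply/subvP => y _.
by have [x <-] := s y; apply: memv_img; apply: memvf.
Qed.

Lemma mod_isoP M N : mod_iso M N <-> iso M N.
Proof.
split=> [[f [fH fb]]|[f [g [gf fg]]]].
  have [f' f'E] : exists f' : Hom M N, forall x, f' @@ x = f x.
    by apply: mkmapp => [c x y|x a]; [rewrite linearP | move/mhomP: fH].
  have [h fK hK] := fb.
  have [h' h'E] : exists h' : Hom N M, forall x, h' @@ x = h x.
    apply: mkmapp => [c x y|x a]; apply: (can_inj fK); rewrite hK.
      by rewrite linearP /= !hK.
    by move/mhomP: fH => ->; rewrite hK.
  by exists f', h'; split; apply: mext => x; rewrite mappC mapp1 f'E h'E.
exists (vsval (f : mh M N)); split; first exact: subvsP.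
exists (mapp g) => x.
  by rewrite -[LHS]/(g @@ f @@ x) -mappC gf mapp1.
by rewrite -[LHS]/(f @@ g @@ x) -mappC fg mapp1.
Qed.

Lemma mhom0P M N : mhom M N = 0%VS <-> forall f : Hom M N, f = 0.
Proof.
split=> [e f|H].
  apply: mext => x; rewrite mapp0 /mapp; have := subvsP (f : mh M N).
  by move: (vsval _) => g; rewrite e memv0 => /eqP ->; rewrite zero_lfunE.
apply/eqP; rewrite -subv0; apply/subvP => f fM; rewrite memv0; apply/eqP.
rewrite -(vsprojK fM).
by have -> : vsproj (mhom M N) f = 0 by [exact: (H (vsproj (mhom M N) f))].
Qed.

Lemma surj_inj_iso M N (f : Hom M N) :
  injective (mapp f) -> msurj f -> is_iso f.
Proof.
move=> fi fs; have [h hK] := fun_choice fs.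
have [h' h'E] : exists h' : Hom N M, forall x, h' @@ x = h x.
  by apply: mkmapp => [c x y|x a]; apply: fi; rewrite ?mlin ?mact !hK.
exists h'; split; apply: mext => x; rewrite mappC mapp1 h'E //.
by apply: fi.
Qed.

(** ** Kernels *)

Definition mker M N (f : Hom M N) : mods := kermod (subvsP (f : mh M N)).

Definition subincl M (U : {vspace (M : rmod L)}) (US : submodule U) :
  Hom (rsub US : mods) M := mkmh (fun x : rsub US => vsval (x : subvs_of U)).

Lemma subinclE M U (US : submodule U) x :
  @subincl M U US @@ x = vsval (x : subvs_of U).
Proof.
apply: mkmhE => [c y z|y a]; first by rewrite linearP.
by rewrite [act y a]/act /= vsprojK //; apply: (US); apply: subvsP.
Qed.

Lemma subincl_inj M (U : {vspace (M : rmod L)}) (US : submodule U) :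
  injective (mapp (subincl US)).
Proof. by move=> x y; rewrite !subinclE; apply: val_inj. Qed.

Lemma subincl_img M (U : {vspace (M : rmod L)}) (US : submodule U) x :
  (exists z, subincl US @@ z = x) <-> x \in U.
Proof.
split=> [[z <-]|xU]; first by rewrite subinclE; apply: subvsP.
by exists (vsproj U x); rewrite subinclE vsprojK.
Qed.

Definition mincl M N (f : Hom M N) : Hom (mker f) M :=
  subincl (lker_submodule (subvsP (f : mh M N))).

Lemma mincl_inj M N (f : Hom M N) : injective (mapp (mincl f)).
Proof. exact: subincl_inj. Qed.

Lemma mincl_ker M N (f : Hom M N) x :
  (exists z, mincl f @@ z = x) <-> f @@ x = 0.
Proof.
rewrite (subincl_img (lker_submodule (subvsP (f : mh M N)))) memv_ker.
by split=> [/eqP|fx0]; last exact/eqP.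
Qed.

Lemma modcat_split : split_idempotents mods.
Proof.
move=> M e ee; pose i := mincl (idm M - e).
have ii : injective (mapp i) by apply: mincl_inj.
have i0 z : (idm M - e) @@ i @@ z = 0 by apply/mincl_ker; exists z.
have ei z : e @@ i @@ z = i @@ z.
  by apply/esym/eqP; rewrite -subr_eq0 -{1}[i @@ z]mapp1 -mappB i0.
have ek x : exists z, i @@ z = e @@ x.
  by apply/mincl_ker; rewrite mappB mapp1 -!mappC ee subrr.
have [h hK] := fun_choice ek.
have [r rE] : exists r : Hom M (mker (idm M - e)), forall x, r @@ x = h x.
  by apply: mkmapp => [c x y|x a]; apply: ii; rewrite ?mlin ?mact !hK ?mlin ?mact.
exists (mker (idm M - e)), r, i; split; apply: mext => x; rewrite mappC rE.
  by rewrite hK.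
by apply: ii; rewrite hK ei mapp1.
Qed.

Lemma rpow_cpow (M : mods) r : iso (rpow M r : mods) (cpow M r).
Proof.
have proj r' i : exists p : Hom (rpow M r' : mods) M, forall x, p @@ x = x i.
  by apply: mkmapp => [c x y|x a]; rewrite !ffunE.
elim: r => [|r IH].
  apply: zero_iso; last exact: zobP.
  by apply: mext => x; apply/ffunP => -[].
apply: iso_trans (iso_bip (iso_refl M) IH) => /=.
have [p pE] := proj r.+1 ord0.
have [q qE] : exists q : Hom (rpow M r.+1 : mods) (rpow M r),
    forall x, q @@ x = [ffun i => x (lift ord0 i)].
  by apply: mkmapp => [c x y|x a]; apply/ffunP => i; rewrite !ffunE.
pose f (x : rsum M (rpow M r)) : rpow M r.+1 :=
  [ffun i => if unlift ord0 i is Some j then x.2 j else x.1].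
have [g gE] : exists g : Hom (bip (l := mods) M (rpow M r)) (rpow M r.+1),
    forall x, g @@ x = f x.
  by apply: mkmapp => [c x y|x a]; apply/ffunP => i; rewrite !ffunE;
    case: unliftP => [j|] _ /=; rewrite ?ffunE.
exists (mpair p q), g; split.
  apply: mext => x; rewrite mappC gE mapp1.
  have e1 : (mpair p q @@ x).1 = x ord0.
    by rewrite -pE -[in RHS](pr1_mpair p q) mappC [RHS]mh_pr1E.
  have e2 : (mpair p q @@ x).2 = [ffun i => x (lift ord0 i)].
    by rewrite -qE -[in RHS](pr2_mpair p q) mappC [RHS]mh_pr2E.
  apply/ffunP => i; rewrite ffunE e1 e2; case: unliftP => [j|] -> //=.
  by rewrite ffunE.
apply: bip_ext_pr; rewrite compA ?pr1_mpair ?pr2_mpair compm1; apply: mext => x;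
  rewrite mappC gE ?pE ?qE.
  by rewrite ffunE unlift_none [RHS]mh_pr1E.
apply/ffunP => i; rewrite !ffunE liftK.
by have -> : pr2 M (rpow M r : mods) @@ x = x.2 by apply: mh_pr2E.
Qed.

Lemma addmodP M N : addmod M N <-> idsum M N.
Proof.
split=> [[r [N' /mod_isoP NN']]|].
  apply: addob_idsum; exists r, N'.
  by apply: iso_trans (rpow_cpow M r).
move=> /(idsum_addob modcat_split) [r [N' iNN']]; exists r, N'; apply/mod_isoP.
by apply: iso_trans (iso_sym (rpow_cpow M r)).
Qed.

End ModuleMaps.

(** * Projective modules *)

Section Projective.
Variables (k : fieldType) (L : fdalg k).
Local Notation mods := (modcat L).
Local Notation regm := (regm L : mods).
Implicit Types M N P Q : mods.

(** A dual basis writes the identity of [P] as a finite sum of maps through the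
    regular module.  Maps out of [P] are then lifted, and traces on [Hom(P, N)]
    are computed, by explicit finite sums. *)
Definition dual_basis P : Prop := exists l : seq ((P : rmod L) * Hom P regm),
  forall x, x = \sum_(b <- l) act b.1 (b.2 @@ x).

Lemma actD M (x : (M : rmod L)) a b : act x (a + b) = act x a + act x b.
Proof. by have := act_linr x 1 a b; rewrite !scale1r. Qed.

Lemma actZ M (x : (M : rmod L)) c a : act x (c *: a) = c *: act x a.
Proof. by rewrite -!(actvE x) linearZ. Qed.

Lemma mouter (I : eqType) (P M : mods) (l : seq I) (m : I -> (M : rmod L))
    (f : I -> Hom P regm) :
  exists h : Hom P M, forall x, h @@ x = \sum_(i <- l) act (m i) (f i @@ x).
Proof.
apply: mkmapp => [c x y|x a].
  rewrite scaler_sumr -big_split; apply: eq_bigr => i _ /=.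
  by rewrite mlin actD actZ.
rewrite -[act (\sum_(_ <- _) _) a]actfE linear_sum /=; apply: eq_bigr => i _.
by rewrite mact actfE actA.
Qed.

Lemma mouter1 P M (m : (M : rmod L)) (f : Hom P regm) :
  exists h : Hom P M, forall x, h @@ x = act m (f @@ x).
Proof.
have [h hE] := mouter [:: tt] (fun => m) (fun => f).
by exists h => x; rewrite hE big_seq1.
Qed.

Lemma dual_lift P A B (d : Hom A B) (f : Hom P B) : dual_basis P ->
  (forall x, exists y, d @@ y = f @@ x) -> exists h, d ∘ h = f.
Proof.
move=> [l lP] /fun_choice [y yE].
have [h hE] := mouter (iota 0 (size l)) (fun i => y (nth (0, 0) l i).1)
  (fun i => (nth (0, 0) l i).2).
exists h; apply: mext => x; rewrite mappC hE mlin_sum [in RHS](lP x) mlin_sum.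
rewrite -[in RHS](mkseq_nth (0, 0) l) /mkseq big_map; apply: eq_bigr => i _.
by rewrite !mact yE.
Qed.

Lemma dual_projective P : dual_basis P -> projective P.
Proof.
move=> Pdual M N g f gH gS fH.
have [|h hE] := @dual_lift P M N (vsproj _ g) (vsproj _ f) Pdual.
  move=> x; have /memv_imgP [y _ e] : f x \in limg g by rewrite gS memvf.
  by exists y; rewrite /mapp /= !vsprojK.
exists (vsval (h : mh P M)); first exact: subvsP.
apply/lfunP => x; have := congr1 (fun u => u @@ x) hE.
by rewrite mappC /mapp /= !vsprojK // comp_lfunE.
Qed.

Lemma dual_retract P Q : retract P Q -> dual_basis Q -> dual_basis P.
Proof.
move=> [s [r rs]] [l lQ]; exists [seq (r @@ b.1, b.2 ∘ s) | b <- l] => x.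
rewrite big_map -{1}[x]mapp1 -rs mappC [s @@ x]lQ mlin_sum.
by apply: eq_bigr => b _; rewrite mact mappC.
Qed.

Lemma free_dual r : dual_basis (rpow regm r : mods).
Proof.
have pex (i : 'I_r) : exists p : Hom (rpow regm r : mods) regm,
    forall x, p @@ x = x i.
  by apply: mkmapp => [c x y|x a]; rewrite !ffunE.
have [p pE] := fun_choice pex.
exists [seq ([ffun j => if i == j then aone L else 0] : rpow regm r, p i)
       | i <- enum 'I_r] => x.
rewrite big_map big_enum /=; apply/ffunP => j.
rewrite sum_ffunE (bigD1 j) //= big1 => [|i /negbTE nij].
  by rewrite !ffunE eqxx pE addr0 amul1l.
by rewrite !ffunE nij; apply: (@act0m _ _ (Defs.regm L)).
Qed.

Lemma free_cover M : exists r (g : Hom (rpow regm r : mods) M), msurj g.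
Proof.
pose r := \dim (fullv : {vspace (M : rmod L)}).
pose b (i : 'I_r) := (vbasis (fullv : {vspace (M : rmod L)}))`_i.
have [g gE] : exists g : Hom (rpow regm r : mods) M,
    forall x, g @@ x = \sum_i act (b i) (x i).
  apply: mkmapp => [c x y|x a].
    rewrite scaler_sumr -big_split; apply: eq_bigr => i _ /=.
    by rewrite !ffunE actD actZ.
  rewrite -[act (\sum_(_ < _) _) a]actfE linear_sum /=; apply: eq_bigr => i _.
  by rewrite actfE actA ffunE.
exists r, g => y; exists [ffun i => coord (vbasis fullv) i y *: aone L].
rewrite gE [RHS](coord_vbasis (memvf y)); apply: eq_bigr => i _.
by rewrite ffunE actZ act1.
Qed.

Lemma projective_lift P A B (g : Hom A B) (f : Hom P B) :
  projective P -> msurj g -> exists h, g ∘ h = f.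
Proof.
move=> Pproj gs.
have [h hH e] := Pproj A B (vsval (g : mh A B)) (vsval (f : mh P B))
  (subvsP _) ((msurjP g).2 gs) (subvsP _).
exists (vsproj _ h); apply: mext => x; rewrite mappC /mapp /= vsprojK //.
by rewrite -comp_lfunE e.
Qed.

Lemma projectiveP P : projective P <-> dual_basis P.
Proof.
split; last exact: dual_projective.
move=> Pproj; have [r [g gs]] := free_cover P.
have [s gsE] := projective_lift (idm P) Pproj gs.
by apply: dual_retract (free_dual r); exists s, g.
Qed.

(** ** Projective covers and minimal resolutions *)

Lemma limg_submodule M N (f : Hom M N) : submodule (limg (vsval (f : mh M N))).
Proof.
move=> y a /memv_imgP [x _ ->]; rewrite -/(f @@ x) -mact.
by apply: memv_img; apply: memvf.
Qed.

(** The image of [e] is a submodule that, together with the kernel of [d], spans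
    [Q]. *)
Lemma superfluous_surj Q M R (d : Hom Q M) (e : Hom R Q) :
  superfluous (lker (vsval (d : mh Q M))) ->
  (forall x, exists y, d @@ e @@ y = d @@ x) -> msurj e.
Proof.
move=> sup H; apply/msurjP; apply: sup; first exact: limg_submodule.
apply/eqP; rewrite eqEsubv subvf; apply/subvP => x _.
have [y dy] := H x; rewrite -[x](subrK (e @@ y)); apply: memv_add.
  by rewrite memv_ker -/(d @@ (x - e @@ y)) mlinB dy subrr.
by apply: memv_img; apply: memvf.
Qed.

Lemma surj_endo_iso M (f : Hom M M) : msurj f -> is_iso f.
Proof.
move=> fs; apply: surj_inj_iso => //; apply/lker0P.
have := limg_ker_dim (vsval (f : mh M M)) fullv; rewrite capfv ((msurjP f).2 fs).
by rewrite -dimv_eq0 -{2}[\dim fullv]add0n => /eqP; rewrite eqn_add2r.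
Qed.

Lemma inj_dim_img M N (f : Hom M N) (V : {vspace (M : rmod L)}) :
  injective (mapp f) -> \dim (vsval (f : mh M N) @: V) = \dim V.
Proof. by move=> /lker0P/eqP f0; rewrite limg_dim_eq // f0 capv0. Qed.

Lemma min_supplement M (K : {vspace (M : rmod L)}) :
  exists U : {vspace (M : rmod L)}, [/\ submodule U, (U + K)%VS = fullv &
    forall V, submodule V -> (V + K)%VS = fullv -> (\dim U <= \dim V)%N].
Proof.
have [|U [US UK] Umin] := @ex_minimizer {vspace (M : rmod L)}
  (fun U => submodule U /\ (U + K)%VS = fullv) (fun U => \dim U).
  exists fullv; split; first by move=> x a _; apply: memvf.
  by apply/eqP; rewrite eqEsubv subvf addvSl.
by exists U; split=> // V VS VK; apply: Umin.
Qed.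

(** A submodule [U] of a free module [F] that is minimal among the supplements
    of the kernel of a surjection [F -> M] still surjects onto [M], so [F] has an
    endomorphism over [M] with values in [U].  By minimality it maps [U] onto
    itself, which makes [U] a retract of [F], hence projective. *)
Lemma proj_cover M : exists P (p : Hom P M),
  [/\ dual_basis P, msurj p & superfluous (lker (vsval (p : mh P M)))].
Proof.
have [r [g gs]] := free_cover M; set F := (rpow _ _ : mods) in g gs.
pose K := lker (vsval (g : mh F M)).
have KE x : (x \in K) = (g @@ x == 0) by rewrite memv_ker.
have [U [US UK Umin]] := min_supplement K.
pose i := subincl US; have ii : injective (mapp i).
  exact: subincl_inj.
have Usurj : msurj (g ∘ i).
  move=> y; have [x <-] := gs y; have := memvf x; rewrite -UK.
  move=> /memv_addP [u uU [v]]; rewrite KE => /eqP gv0 ->.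
  by have [u' <-] := (subincl_img US u).2 uU; exists u'; rewrite mappC mlinD gv0 addr0.
have suppl (V : {vspace (F : rmod L)}) :
    (forall y, exists2 x, x \in V & g @@ x = y) -> (V + K)%VS = fullv.
  move=> H; apply/eqP; rewrite eqEsubv subvf; apply/subvP => x _.
  have [z zV gz] := H (g @@ x); rewrite -[x](subrK z) addrC; apply: memv_add => //.
  by rewrite KE mlinB gz subrr.
have [h gih] := dual_lift (d := g ∘ i) (f := g) (free_dual r) (fun x => Usurj _).
have isurj : msurj (h ∘ i).
  apply/msurjP; apply/eqP; rewrite eqEdim subvf /=.
  have -> : \dim (limg (vsval (h ∘ i : mh _ _))) =
            \dim (limg (vsval (i ∘ (h ∘ i) : mh _ _))).
    have -> : limg (vsval (i ∘ (h ∘ i) : mh _ _)) =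
        (vsval (i : mh _ _) @: limg (vsval (h ∘ i : mh _ _)))%VS.
      rewrite -limg_comp; congr lfun_img; apply/lfunP => x.
      by rewrite comp_lfunE; apply: mappC.
    exact/esym/inj_dim_img.
  rewrite dimvf; have -> : dim (rsub US) = \dim U by [].
  apply: Umin; first exact: limg_submodule.
  apply: suppl => y; have [u <-] := Usurj y.
  exists ((i ∘ (h ∘ i)) @@ u); first by apply: memv_img; apply: memvf.
  by rewrite -{2}gih !mappC.
(* c h is a retraction of the inclusion i *)
have [c [ch _]] := surj_endo_iso isurj.
exists (rsub US), (g ∘ i); split=> //.
  by apply: dual_retract (free_dual r); exists i, (c ∘ h); rewrite -compA.
move=> V VS VK; apply/eqP; rewrite eqEdim subvf /=.
have iV := inj_dim_img V ii.
rewrite dimvf -iV; have -> : dim (rsub US) = \dim U by [].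
apply: Umin.
  move=> x a /memv_imgP [u uV ->]; rewrite -/(i @@ u) -mact.
  by apply: memv_img; apply: VS.
apply: suppl => y; have [u <-] := Usurj y.
have := memvf u; rewrite -VK => /memv_addP [u0 + [v vV ->]].
rewrite memv_ker => /eqP u00; exists (i @@ v); first exact: memv_img.
by rewrite -mappC mlinD [(g ∘ i) @@ u0]u00 add0r.
Qed.

(** Projective covers of iterated kernels: [K i] is the [i]-th syzygy, and the
    [i]-th differential is the cover of [K (i + 1)] followed by its inclusion. *)
Lemma minres_exists (M : rmod L) : inhabited (minres M).
Proof.
have [c cP] : exists c : forall N : mods, {P : mods & Hom P N}, forall N,
    [/\ dual_basis (projT1 (c N)), msurj (projT2 (c N)) &
        superfluous (lker (vsval (projT2 (c N) : mh _ N)))].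
  have H (N : mods) : exists c : {P : mods & Hom P N},
    [/\ dual_basis (projT1 c), msurj (projT2 c) &
        superfluous (lker (vsval (projT2 c : mh _ N)))].
    by have [P [p pP]] := proj_cover N; exists (existT _ P p).
  exists (fun N => proj1_sig (constructive_indefinite_description _ (H N))) => N.
  exact: (proj2_sig (constructive_indefinite_description _ (H N))).
pose K i := iter i (fun N => mker (projT2 (c N))) (M : mods).
pose P i := projT1 (c (K i)); pose p i : Hom (P i) (K i) := projT2 (c (K i)).
pose d i : Hom (P i.+1) (P i) := mincl (p i) ∘ p i.+1.
have ps i : msurj (p i) by have [] := cP (K i).
have kd i : lker (vsval (d i : mh _ _)) = lker (vsval (p i.+1 : mh _ _)).
  apply/vspaceP => x; rewrite !memv_ker -/(d i @@ x).
  rewrite mappC -{1}(mlin0 (mincl (p i))) (inj_eq (@mincl_inj _ _ _ _ (p i))).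
  by [].
have ld i : limg (vsval (d i : mh _ _)) = lker (vsval (p i : mh _ _)).
  apply/vspaceP => x; rewrite memv_ker; apply/memv_imgP/eqP.
    move=> [y _ ->]; apply/mincl_ker; exists (p i.+1 @@ y).
    by rewrite -mappC.
  move=> /mincl_ker [z <-]; have [y <-] := ps i.+1 z; exists y.
    exact: memvf.
  by rewrite -mappC.
unshelve refine (inhabits (@MinRes k L M P (fun i => vsval (d i : mh _ _))
  (vsval (p 0 : mh _ _)) _ (fun i => subvsP _) (subvsP _) _ (ld 0%N) _ _ _)).
- by move=> i; apply/projectiveP; have [] := cP (K i).
- exact/msurjP/ps.
- by move=> i; rewrite ld kd.
- by have [] := cP (K 0%N).
- by move=> i; rewrite kd; have [] := cP (K i.+1).
Qed.

End Projective.

(** * The Auslander-Reiten formula *)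

Lemma vspace_separate (k : fieldType) (V : vectType k) (U : {vspace V}) v :
  v \notin U -> exists2 t : 'Hom(V, k^o), (forall u, u \in U -> t u = 0) & t v != 0.
Proof.
move=> vU; pose w := v - projv U v.
have w0 : w != 0.
  by apply: contraNneq vU => /eqP; rewrite subr_eq0 => /eqP ->; apply: memv_proj.
pose q (i : 'I_(\dim {:V})) (u : V) : k^o := coord (vbasis {:V}) i (u - projv U u).
have ql i : linear (q i).
  move=> c x y; rewrite /q linearP opprD addrACA -scalerBr.
  by rewrite linearP.
have [i qi] : exists i, q i v != 0.
  apply/existsP; apply: contraNT w0 => /existsPn H.
  rewrite [w](coord_vbasis (memvf w)) big1 // => i _.
  by move: (H i); rewrite negbK => /eqP qi; rewrite -[coord _ _ _]/(q i v) qi scale0r.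
exists (linfun (q i)) => [u uU|]; rewrite linfunE //.
by rewrite /q projv_id // subrr linear0.
Qed.

Section AuslanderReiten.
Variables (k : fieldType) (L : fdalg k).
Local Notation mods := (modcat L).
Local Notation regm := (regm L : mods).
Implicit Types M N P Q : mods.

(** Over a projective [P], the maps [p |-> x (f p)] with [f] in [Hom(P, L)]
    span [Hom(P, N)]; hence [Hom(N, nu P)] is the dual of [Hom(P, N)].  Under
    this duality the maps into the kernel of [nu d] correspond to the forms on
    [Hom(P, N)] that vanish on the maps factoring through [d]. *)
Lemma hom_ker_nu N P Q (d : Hom P Q) : dual_basis P -> dual_basis Q ->
  mhom N (kermod (nu_map_mhom (subvsP (d : mh P Q)))) = 0%VS <->
  forall f : Hom P N, exists g : Hom Q N, f = g ∘ d.
Proof.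
move=> [l lP] [l' lQ]; set dH := subvsP _; set K := kermod _.
have laction (f : homL P) :
    f = \sum_(b <- l) lact ((f : Hom P regm) @@ b.1) (b.2 : mh _ _).
  apply: mext => p; rewrite {1}[p]lP mlin_sum (mapp_sum (M := P) (N := regm)).
  by apply: eq_bigr => b _; rewrite mact [RHS]lactE.
split=> [K0 f|facts].
  pose I : {vspace (Hom P N)} := limg (linfun (fun g : Hom Q N => g ∘ d)).
  have IE g : linfun (fun g : Hom Q N => g ∘ d) g = g ∘ d.
    exact: (linfunE (comp_linl d)).
  suff : f \in I by move=> /memv_imgP [g _ ->]; exists g; rewrite IE.
  apply: contraT => /vspace_separate [t tI tf].
  (* a form t on Hom(P, N) gives the map N -> nu P sending x to h |-> t (x h) *)
  pose out (x : (N : rmod L)) (h : Hom P regm) : Hom P N :=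
    mkmh (fun p : P => act x (h @@ p)).
  have outE x h p : out x h @@ p = act x (h @@ p).
    apply: mkmhE => [c u v|u a]; first by rewrite mlin actD actZ.
    by rewrite mact actA.
  have out_linl h : linear (out^~ h).
    by move=> c x y; apply: mext => p; rewrite mappL !outE (act_linl _ c).
  have out_linr x : linear (out x).
    by move=> c h h'; apply: mext => p; rewrite mappL !outE mappL actD actZ.
  pose xi (x : (N : rmod L)) : nu P := linfun (fun h : homL P => t (out x h)).
  have xiE x h : (xi x : 'Hom(homL P, k^o)) h = t (out x h).
    by apply: linfunE => c u v; rewrite out_linr linearP.
  have xiK x : xi x \in lker (nu_map (vsval (d : mh P Q))).
    rewrite memv_ker; apply/eqP/lfunP => h; rewrite nu_mapE // zero_lfunE xiE.
    apply: tI; have [g gE] := mouter1 x (h : Hom Q regm).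
    have -> : out x (homL_map (vsval (d : mh P Q)) h) = g ∘ d.
      by apply: mext => p; rewrite outE mappC gE; congr (act x _); apply: homL_mapE.
    by rewrite -IE memv_img // memvf.
  have [F FE] : exists F : Hom N (K : mods),
      forall x, F @@ x = vsproj (lker (nu_map (vsval (d : mh P Q)))) (xi x).
    apply: mkmapp => [c x y|x a]; apply: val_inj.
      rewrite linearP /= !vsprojK //; apply/lfunP => h.
      by rewrite add_lfunE scale_lfunE !xiE out_linl linearP.
    rewrite /= vsprojK // [RHS]vsprojK; last first.
      by apply: (lker_submodule (nu_map_mhom dH)); apply: subvsP.
    rewrite vsprojK //; apply/lfunP => h.
    rewrite xiE comp_lfunE (linfunE (@lact_linr _ _ P a)) xiE.
    congr (t _); apply: mext => p; rewrite !outE actA; congr (act x _).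
    exact/esym/lactE.
  have tout x h : t (out x h) = 0.
    rewrite -xiE -[xi x](vsprojK (xiK x)) -FE.
    have -> : F = 0 by apply: ((mhom0P N (K : mods)).1 K0).
    by rewrite mapp0 linear0 zero_lfunE.
  suff fE : f = \sum_(b <- l) out (f @@ b.1) b.2.
    move: tf; rewrite fE linear_sum big1 ?eqxx // => b _.
    exact: tout.
  apply: mext => p; rewrite {1}[p]lP mlin_sum mapp_sum; apply: eq_bigr => b _.
  by rewrite mact outE.
apply/mhom0P => F; apply: mext => x; rewrite mapp0; apply: val_inj.
pose xi y : nu P := vsval (F @@ y : subvs_of (lker (nu_map (vsval (d : mh P Q))))).
rewrite -[LHS]/(xi x) linear0; apply/lfunP => f; rewrite zero_lfunE.
have xiK y h : (xi y : 'Hom(homL P, k^o)) (homL_map (vsval (d : mh P Q)) h) = 0.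
  rewrite -nu_mapE //; have : xi y \in lker (nu_map (vsval (d : mh P Q))).
    exact: subvsP.
  by rewrite memv_ker => /eqP ->; rewrite zero_lfunE.
have xiA y a h : (xi (act y a) : 'Hom(homL P, k^o)) h =
    (xi y : 'Hom(homL P, k^o)) (lact a h).
  rewrite /xi mact {1}/act /= vsprojK.
    by rewrite comp_lfunE (linfunE (@lact_linr _ _ P a)).
  by apply: (lker_submodule (nu_map_mhom dH)); apply: subvsP.
have xi_sum (I : Type) (r : seq I) (y : I -> (N : rmod L)) :
    xi (\sum_(i <- r) y i) = \sum_(i <- r) xi (y i).
  by rewrite /xi mlin_sum linear_sum.
(* xi y is recovered from the trace over the dual basis of p |-> y (h p) *)
have traceE y (h : homL P) : \sum_(b <- l)
    (xi (act y ((h : Hom P regm) @@ b.1)) : 'Hom(homL P, k^o)) (b.2 : homL P) =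
    (xi y : 'Hom(homL P, k^o)) h.
  rewrite [h in RHS]laction linear_sum; apply: eq_bigr => b _.
  exact: xiA.
rewrite -traceE; have [g gE] := mouter1 x (f : Hom P regm).
have [g' g'E] := facts g.
transitivity (\sum_(b <- l) \sum_(c <- l')
   (xi (act (g' @@ c.1) (((c.2 : Hom Q regm) ∘ d) @@ b.1)) : 'Hom(homL P, k^o))
     (b.2 : homL P)).
  apply: eq_bigr => b _; rewrite -gE g'E mappC {1}[d @@ b.1]lQ mlin_sum xi_sum.
  rewrite sum_lfunE; apply: eq_bigr => c _.
  by rewrite mact mappC.
rewrite exchange_big /= big1 // => c _; rewrite (traceE _ ((c.2 : Hom Q regm) ∘ d)).
exact: xiK.
Qed.

(** The resolution is the one chosen in the definition of [tau], of which only
    minimality is known; it has to be compared with the ones coming from angles. *)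
Lemma hom_tau N (M : rmod L) n : exists R : minres M,
  mhom N (tau n.+1 M) = 0%VS <->
  forall f : Hom (res R n.+1 : mods) N,
    exists g, forall x, f @@ x = g @@ (res_d R n x).
Proof.
pose K := fun X => exists R : minres M,
  X = kermod (nu_map_mhom (res_d_mhom R n)).
have [R ->] : K (tau n.+1 M).
  apply: epsilon_spec; have [R] := minres_exists M.
  by exists (kermod (nu_map_mhom (res_d_mhom R n))), R.
exists R; have [d dE] : exists d : Hom (res R n.+1 : mods) (res R n),
    vsval (d : mh _ _) = res_d R n.
  by exists (vsproj _ (res_d R n)); rewrite vsprojK ?res_d_mhom.
have Rdual i : dual_basis (res R i) by apply/projectiveP/res_proj.
have := @hom_ker_nu N _ _ d (Rdual _) (Rdual _).
move: (subvsP _) (res_d_mhom R n); rewrite dE => dH dH'.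
rewrite (bool_irrelevance dH' dH) => ->; split=> H f.
  by have [g ->] := H f; exists g => x; rewrite mappC /mapp dE.
have [g gE] := H f; exists g; apply: mext => x.
by rewrite gE mappC /mapp dE.
Qed.

End AuslanderReiten.

(** * Comparison with a minimal resolution *)

Section Comparison.
Variables (k : fieldType) (L : fdalg k).
Local Notation mods := (modcat L).
Implicit Types A B M N P Q R : mods.

Definition mexact A B M (f : Hom A B) (g : Hom B M) : Prop :=
  forall x, (exists y, f @@ y = x) <-> g @@ x = 0.

(** The stage in degree [i] of a comparison of a resolution [Q] with a minimal
    resolution [R] of the same module, where [d] and [del] start in degree [i]:
    lifts [f] and [g] of the identity, and a homotopy [s] from [f g] to [1].  Only
    what the next degree needs is recorded: how [f] and [g] behave on kernels. *)
Definition comparable A B Q R (d : Hom Q A) (del : Hom R B) : Prop :=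
  exists (f : Hom R Q) (g : Hom Q R) (s : Hom A Q),
  [/\ forall x, del @@ x = 0 -> d @@ f @@ x = 0,
      forall x, d @@ x = 0 -> del @@ g @@ x = 0,
      is_iso (g ∘ f) & d ∘ (f ∘ g - idm Q - s ∘ d) = 0].

(** Two consecutive stages: the maps [f0] and [g0] in the lower degree make the
    lifts commute with the differentials, which lets factorizations through [d]
    and [del] be exchanged. *)
Definition compared A B Q R (d : Hom Q A) (del : Hom R B) : Prop :=
  exists (f : Hom R Q) (g : Hom Q R) (s : Hom A Q) (f0 : Hom B A) (g0 : Hom A B),
  [/\ d ∘ f = f0 ∘ del, del ∘ g = g0 ∘ d, is_iso (g ∘ f) &
      d ∘ (f ∘ g - idm Q - s ∘ d) = 0].

Lemma compared_comparable A B Q R (d : Hom Q A) (del : Hom R B) :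
  compared d del -> comparable d del.
Proof.
move=> [f [g [s [f0 [g0 [df delg gf h]]]]]]; exists f, g, s.
split=> // x x0; rewrite -mappC.
  by rewrite df mappC x0 mlin0.
by rewrite delg mappC x0 mlin0.
Qed.

Lemma cover_endo_iso R B (del : Hom R B) (e : Hom R R) :
  superfluous (lker (vsval (del : mh R B))) -> del ∘ e = del -> is_iso e.
Proof.
move=> sup dele; apply: surj_endo_iso; apply: superfluous_surj sup _ => x.
by exists x; rewrite -mappC dele.
Qed.

Lemma comparable_cover A B Q R (d : Hom Q A) (del : Hom R B) :
  iso A B -> dual_basis Q -> dual_basis R -> msurj d -> msurj del ->
  superfluous (lker (vsval (del : mh R B))) -> comparable d del.
Proof.
move=> [t [t' [tt' t't]]] Qdual Rdual ds dels sup.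
have [f df] := dual_lift (d := d) (f := t' ∘ del) Rdual (fun x => ds _).
have [g delg] := dual_lift (d := del) (f := t ∘ d) Qdual (fun x => dels _).
exists f, g, 0; split=> [x x0|x x0||].
- by rewrite -mappC df mappC x0 mlin0.
- by rewrite -mappC delg mappC x0 mlin0.
- by apply: cover_endo_iso sup _; rewrite compA delg -compA df compA t't comp1m.
by rewrite comp0m subr0 compBr compA df -compA delg compA tt' comp1m compm1 subrr.
Qed.

(** An injective endomorphism of the kernel is onto, for dimension reasons. *)
Lemma iso_ker_surj R B (del : Hom R B) (e : Hom R R) : is_iso e ->
  (forall x, del @@ x = 0 -> del @@ e @@ x = 0) ->
  forall x, del @@ x = 0 -> exists2 y, del @@ y = 0 & e @@ y = x.
Proof.
move=> [e' [e'e _]] eK x x0; pose K := lker (vsval (del : mh R B)).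
have eKK : (vsval (e : mh R R) @: K)%VS = K.
  apply/eqP; rewrite eqEdim; apply/andP; split.
    apply/subvP => y /memv_imgP [z]; rewrite !memv_ker => /eqP z0 ->.
    by apply/eqP/eK.
  rewrite (inj_dim_img (f := e)) // => y z.
  by move/(congr1 (mapp e')); rewrite -!mappC e'e !mapp1.
have : x \in K by rewrite memv_ker; apply/eqP.
by rewrite -eKK => /memv_imgP [y]; rewrite memv_ker => /eqP y0 ->; exists y.
Qed.

(** The usual construction of lifts and of a homotopy by induction on the degree.
    The composite [g' f'] is surjective because it lifts [g f], which maps the
    image of [del'] onto itself, and the kernel of [del'] is superfluous. *)
Lemma comparison_step A B Q R (d : Hom Q A) (del : Hom R B) Q' R'
    (d' : Hom Q' Q) (del' : Hom R' R) :
  comparable d del -> dual_basis Q -> dual_basis Q' -> dual_basis R' ->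
  mexact d' d -> mexact del' del ->
  superfluous (lker (vsval (del' : mh R' R))) -> compared d' del'.
Proof.
move=> [f [g [s [kf kg gf hs]]]] Qdual Q'dual R'dual ed edel sup.
have d'd y : d @@ d' @@ y = 0 by apply/ed; exists y.
have del'del y : del @@ del' @@ y = 0 by apply/edel; exists y.
have [|f' df'] := dual_lift (d := d') (f := f ∘ del') R'dual.
  by move=> x; apply/ed; rewrite mappC; apply: kf.
have [|g' delg'] := dual_lift (d := del') (f := g ∘ d') Q'dual.
  by move=> x; apply/edel; rewrite mappC; apply: kg.
have [|s' ds'] := dual_lift (d := d') (f := f ∘ g - idm Q - s ∘ d) Qdual.
  by move=> x; apply/ed; rewrite -mappC hs mapp0.
have dd' : d ∘ d' = 0 by apply: mext => x; rewrite mappC d'd mapp0.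
exists f', g', s', f, g; split=> //.
  apply: surj_endo_iso; apply: superfluous_surj sup _ => x.
  have [y y0 ey] := iso_ker_surj gf
    (fun y y0 => etrans (congr1 _ (mappC _ _ _)) (kg _ (kf _ y0))) (del'del x).
  have [z ez] := (edel y).2 y0; exists z.
  by rewrite -ey -ez -mappC compA delg' -compA df' !mappC.
rewrite compBr compBr compm1 (compA d' f') df' (compA d' s') ds' -compA delg'.
by rewrite !compBl comp1m -(compA s) dd' compm0 subr0 -!compA subrr.
Qed.

Lemma compared_factor A B Q R (d : Hom Q A) (del : Hom R B) N :
  compared d del -> (forall u : Hom Q N, exists v, u = v ∘ d) ->
  forall u : Hom R N, exists v, u = v ∘ del.
Proof.
move=> [f [g [s [f0 [g0 [df _ [c [cgf _]] _]]]]]] H u.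
have [v uv] := H (u ∘ c ∘ g); exists (v ∘ f0).
by rewrite -[LHS]compm1 -cgf !compA uv -!compA df.
Qed.

(** The endomorphism [h = f g - 1 - s d] of [Q] has [d h = 0], and [u (1 + h)]
    factors through [d] as soon as [u f] factors through [del]. *)
Lemma factor_compared A B Q R (d : Hom Q A) (del : Hom R B) N :
  compared d del ->
  (forall h : Hom Q Q, d ∘ h = 0 -> exists c, (idm Q + h) ∘ c = idm Q) ->
  (forall u : Hom R N, exists v, u = v ∘ del) ->
  forall u : Hom Q N, exists v, u = v ∘ d.
Proof.
move=> [f [g [s [f0 [g0 [df delg _ dh]]]]]] unit H u.
pose h := f ∘ g - idm Q - s ∘ d; have [c hc] := unit h dh.
have [v uf] := H (u ∘ f); exists (v ∘ g0 - u ∘ s).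
have dc : d ∘ c = d by rewrite -[RHS]compm1 -hc compA compDr compm1 dh addr0.
rewrite -[LHS]compm1 -hc compA -dc [RHS]compA; congr (_ ∘ c).
rewrite /h addrA addrCA subrr addr0 compBr compA uf -compA delg compBl.
by rewrite !compA.
Qed.

End Comparison.

(** * Exactness of angles *)

Section Exactness.
Variables (k : fieldType) (C : lincat k).
Implicit Types X Y Z W : C.

(** Exactness of all functors [C(W, -)] and [C(-, W)] at the middle object; angles
    have it, although [f] and [g] need not be a kernel and a cokernel. *)
Definition exact_pair X Y Z (f : Hom X Y) (g : Hom Y Z) : Prop :=
  [/\ g ∘ f = 0,
      forall W (u : Hom W Y), g ∘ u = 0 -> exists v, u = f ∘ v &
      forall W (u : Hom Y W), u ∘ f = 0 -> exists v, u = v ∘ g].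

Definition shob m {X Z} : seqn m X Z -> C :=
  match m with 0 => fun _ => Z | m'.+1 => fun s => projT1 s end.

Definition shd m {X Z} : forall s : seqn m X Z, Hom X (shob s) :=
  match m with 0 => fun d => d | m'.+1 => fun s => (projT2 s).1 end.

Fixpoint slast m {X Z} : seqn m X Z -> {Y : C & Hom Y Z} :=
  match m with
  | 0 => fun d => existT _ X d
  | m'.+1 => fun s => slast (projT2 s).2
  end.

(** Indices of objects that do not exist give no condition. *)
Fixpoint exact_at j m {X Z} : seqn m X Z -> Prop :=
  match m with
  | 0 => fun _ => True
  | m'.+1 => fun s =>
      if j is j'.+1 then exact_at j' (projT2 s).2
      else exact_pair (projT2 s).1 (shd (projT2 s).2)
  end.

Lemma exact_at_prefix j m X Z W (s : seqn m X Z) (h : Hom Z W) :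
  (j < m)%N -> exact_at j (srcons s h) -> exact_at j s.
Proof.
elim: m j X s => [|m IH] [|j] X s //; last exact: IH.
by case: s => Y [d s]; case: m s {IH}.
Qed.

Lemma exact_at_last m X Z W (s : seqn m X Z) (h : Hom Z W) :
  exact_at m (srcons s h) -> exact_pair (projT2 (slast s)) h.
Proof. by elim: m X s => [|m IH] X s //; apply: IH. Qed.

Lemma slast_srcons m X Z W (s : seqn m X Z) (h : Hom Z W) :
  slast (srcons s h) = existT _ Z h.
Proof. by elim: m X s => [|m IH] X s //; apply: IH. Qed.

Lemma scommutes_last m X Z W X' Z' W' (s : seqn m X Z) (h : Hom Z W)
    (s' : seqn m X' Z') (h' : Hom Z' W') a
    (phi : scomps (srcons s h) (srcons s' h')) b :
  scommutes a phi b -> exists c, b ∘ h = h' ∘ c.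
Proof.
elim: m X X' s s' a phi => [|m IH] X X' s s' a phi.
  by move=> [_ e]; exists phi.1.
by move=> [_ /IH].
Qed.

Lemma zero_seq_map m X Z X' Z' (s : seqn m X Z) (s' : seqn m X' Z') a b :
  idm X = 0 -> idm X' = 0 ->
  smid_all (fun Y => idm Y = 0) s -> smid_all (fun Y => idm Y = 0) s' ->
  exists phi : scomps s s', sall_iso phi /\ scommutes a phi b.
Proof.
elim: m X X' s s' a => [|m IH] X X' s s' a X0 X'0.
  move=> _ _; exists tt; split=> //=.
  by rewrite (zero_from (b ∘ s) X0) (zero_from (s' ∘ a) X0).
case: s => Y [d s]; case: s' => Y' [d' s'] [/= Y0 sz] [/= Y'0 sz'].
have [phi [phi_iso phi_c]] := IH Y Y' s s' 0 Y0 Y'0 sz sz'.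
exists (0, phi); split=> /=.
  by split=> //; exists 0; rewrite !comp0m Y0 Y'0.
by split=> //; rewrite comp0m (zero_to (d' ∘ _) Y'0).
Qed.

Lemma szero_mid m X Z : smid_all (fun Y : C => idm Y = 0) (@szero _ C m X Z).
Proof. by elim: m X => [|m IH] X //=; split=> //; apply: zobP. Qed.

Lemma smid_all_srcons (P : C -> Prop) m X Z W (s : seqn m X Z) (h : Hom Z W) :
  smid_all P s -> P Z -> smid_all P (srcons s h).
Proof.
by elim: m X s => [|m IH] X s //= [PY sP] PZ; split=> //; apply: IH.
Qed.

Section Suspension.
Variable S : automorphism C.

Lemma amor_inj X Y : injective (@amor _ _ S X Y).
Proof. exact: bij_inj (@amor_bij _ _ S X Y). Qed.

Lemma amor_surj X Y (f : Hom (S X) (S Y)) : exists g, amor S g = f.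
Proof. by have [g _ gK] := @amor_bij _ _ S X Y; exists (g f). Qed.

Lemma susp_surj X : exists Y, S Y = X.
Proof. by have [g _ gK] := @aob_bij _ _ S; exists (g X). Qed.

Lemma amor_zero X : idm (S X) = 0 <-> idm X = 0.
Proof.
rewrite -amor_id; split=> [e|->]; last exact: raddf0.
by apply: (@amor_inj X X); rewrite e raddf0.
Qed.

Lemma susp_retract X Y : retract (S X) (S Y) <-> retract X Y.
Proof.
split=> [[s [r rs]]|[s [r rs]]].
  have [s' es] := amor_surj s; have [r' er] := amor_surj r.
  exists s', r'; apply: (@amor_inj X X).
  by rewrite amor_comp er es rs amor_id.
by exists (amor S s), (amor S r); rewrite -amor_comp rs amor_id.
Qed.

Lemma susp_iso X Y : iso (S X) (S Y) <-> iso X Y.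
Proof.
split=> [[f [g [gf fg]]]|[f [g [gf fg]]]].
  have [f' ef] := amor_surj f; have [g' eg] := amor_surj g.
  exists f', g'; split; apply: amor_inj;
    by rewrite amor_comp ef eg ?gf ?fg amor_id.
by exists (amor S f), (amor S g); rewrite -!amor_comp gf fg !amor_id.
Qed.

Lemma susp_bip X Y : iso (S X ⊕ S Y) (S (X ⊕ Y)).
Proof.
exists (susp_sum S X Y), (mpair (amor S (pr1 X Y)) (amor S (pr2 X Y))).
split; last by rewrite mcopair_mpair -!amor_comp -raddfD bip_id amor_id.
apply: bip_ext_in; apply: bip_ext_pr;
  rewrite comp1m -compA /susp_sum ?mcopair_in1 ?mcopair_in2 compA
    ?pr1_mpair ?pr2_mpair -amor_comp ?(pr1_in1, pr2_in1, pr1_in2, pr2_in2);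
  by rewrite ?amor_id ?raddf0.
Qed.

Lemma sum_through_susp X Y Z (f : Hom Y Z) :
  sum_through (S X) (amor S f) <-> sum_through X f.
Proof.
split=> [[l]|[l ->]].
  have [unS unSK] := fun_choice (@amor_surj X Z).
  have [unS' unSK'] := fun_choice (@amor_surj Y X).
  move=> e; exists [seq (unS x.1, unS' x.2) | x <- l]; apply: amor_inj.
  rewrite e big_map raddf_sum; apply: eq_bigr => x _ /=.
  by rewrite amor_comp unSK unSK'.
exists [seq (amor S x.1, amor S x.2) | x <- l].
by rewrite big_map raddf_sum; apply: eq_bigr => x _; rewrite amor_comp.
Qed.

Lemma idsum_susp X Y : idsum (S X) (S Y) <-> idsum X Y.
Proof. by rewrite /idsum -amor_id; apply: sum_through_susp. Qed.

End Suspension.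

Section Angles.
Variables (m : nat) (S : angulation C m.+1).

(** The identity of [X0] and [d] form a morphism from the trivial angle
    [X0 -> X0 -> 0 -> ...]; its third component starts at [0]. *)
Lemma angle_comp0 X0 X1 (d : Hom X0 X1) (p : seqn m.+1 X1 (S X0)) :
  angle (scons d p) -> shd p ∘ d = 0.
Proof.
move=> ap; have [phi [/= e _]] := angle_mor (phi0 := idm X0) (phi1 := d)
  (angle_id S X0) ap (erefl (d ∘ idm X0)).
by rewrite -e compm0.
Qed.

(** The angle [0 -> W -> W -> 0 -> ... -> S 0]: its rotation is the trivial angle of
    [W] with one zero object replaced by the zero object [S 0]. *)
Lemma angle_id_back W :
  angle (a := S) (scons (0 : Hom (zob C) W) (scons (idm W) (szero m))).
Proof.
apply/angle_rotate; have zS : idm (S (zob C)) = 0 by apply/amor_zero/zobP.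
pose s : seqn m.+1 W (S W) := szero m.+1.
pose s' := srcons (szero m : seqn m W (S (zob C)))
  ((-1) ^+ m.+1 *: amor S (0 : Hom (zob C) W)).
have [psi [psi_iso psi_c]] : exists psi : scomps s s', sall_iso psi /\
    scommutes (idm W) psi (idm (S W)).
  rewrite /s'; have := smid_all_srcons ((-1) ^+ m.+1 *: amor S (0 : Hom (zob C) W))
    (szero_mid m W (S (zob C))) zS.
  rewrite /s; have := szero_mid m.+1 W (S W).
  move: (szero m.+1) (srcons _ _) => [Y [d t]] [Y' [d' t']] [Y0 tz] [Y'0 t'z].
  have [psi [psi_iso psi_c]] := zero_seq_map 0 (idm (S W)) Y0 Y'0 tz t'z.
  exists (0, psi); split=> /=.
    by split=> //; exists 0; rewrite !comp0m Y0 Y'0.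
  by split=> //; rewrite comp0m (zero_to (d' ∘ _) Y'0).
have iso1 : is_iso (idm W) by exists (idm W); rewrite comp1m.
apply: (@angle_iso k C m.+1 S W W (scons (idm W) s) (scons (idm W) s')
  (idm W) (idm W, psi)) => //=.
  by rewrite amor_id.
exact: angle_id.
Qed.

(** For the covariant part, a map [u : W -> X1] with [d1 u = 0] extends to a
    morphism from the rotated trivial angle of [W] to the rotated given angle, and
    its last component is [S v] with [u = d v].  For the contravariant part, a map
    [u : X1 -> W] with [u d = 0] extends to a morphism to [0 -> W -> W -> 0 -> ...],
    and its third component is the required factor. *)
Lemma angle_exact0 X0 X1 (d : Hom X0 X1) (p : seqn m.+1 X1 (S X0)) :
  angle (scons d p) -> exact_pair d (shd p).
Proof.
move=> ap; split; first exact: angle_comp0.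
  case: p ap => X2 [d1 p] ap W u d1u.
  have [phi c] := angle_mor (d := 0) (e := d1)
    (p := srcons (szero m) ((-1) ^+ m.+1 *: amor S (idm W)))
    (q := srcons p ((-1) ^+ m.+1 *: amor S d)) (phi0 := u) (phi1 := 0)
    ((angle_rotate _ _).1 (angle_id S W)) ((angle_rotate _ _).1 ap)
    (etrans (comp0m _ _) (esym d1u)).
  have [v' e] := scommutes_last c; have [v ev] := amor_surj v'.
  exists v; apply: (amor_inj (S := S)); move: e.
  rewrite compZl compZr amor_id compm1 -ev -amor_comp.
  by apply: scalerI; rewrite signr_eq0.
case: p ap => X2 [d1 p] ap W u ud.
have [phi [e _]] := angle_mor (phi0 := 0) (phi1 := u) ap (angle_id_back W)
  (etrans ud (esym (comp0m _ _))).
by exists phi.1; rewrite [RHS]e comp1m.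
Qed.

Lemma angle_exact j X (s : seqn m.+2 X (S X)) :
  angle s -> (j <= m.+1)%N -> exact_at j s.
Proof.
elim: j X s => [|j IH] X [X1 [d p]] ap lt_j; first exact: angle_exact0.
apply: (exact_at_prefix (h := (-1) ^+ m.+1 *: amor S d)) => //.
by apply: IH; [exact: ((angle_rotate _ _).1 ap) | exact: ltnW].
Qed.

End Angles.
End Exactness.

(** * The functor [C(T, -)] *)

Section Functor.
Variables (k : fieldType) (C : lincat k) (T : C).
Local Notation mods := (modcat (endalg T)).
Local Notation F X := (homT T X : mods).
Implicit Types X Y Z A : C.

Definition Fm X Y (a : Hom X Y) : Hom (F X) (F Y) :=
  mkmh (fun u : homT T X => (a ∘ (u : Hom T X) : homT T Y)).

Lemma FmE X Y (a : Hom X Y) (u : Hom T X) : Fm a @@ u = a ∘ u.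
Proof.
apply: mkmhE => [c x y|x b]; first by rewrite compDr compZr.
exact: compA.
Qed.

Lemma FmC X Y Z (b : Hom Y Z) (a : Hom X Y) : Fm (b ∘ a) = Fm b ∘ Fm a.
Proof. by apply: mext => u; rewrite mappC !FmE compA. Qed.

Lemma Fm1 X : Fm (idm X) = idm (F X).
Proof. by apply: mext => u; rewrite mapp1 FmE comp1m. Qed.

Lemma FmD X Y (a b : Hom X Y) : Fm (a + b) = Fm a + Fm b.
Proof. by apply: mext => u; rewrite mappD !FmE compDl. Qed.

Lemma Fm0 X Y : Fm (0 : Hom X Y) = 0.
Proof. by apply: mext => u; rewrite mapp0 FmE comp0m. Qed.

Lemma FmB X Y (a b : Hom X Y) : Fm (a - b) = Fm a - Fm b.
Proof. by apply: mext => u; rewrite mappB !FmE compBl. Qed.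

Lemma Fm_sum X Y (I : Type) (r : seq I) (a : I -> Hom X Y) :
  Fm (\sum_(i <- r) a i) = \sum_(i <- r) Fm (a i).
Proof. exact: (big_morph (@Fm X Y) (@FmD X Y) (Fm0 X Y)). Qed.

Lemma F_iso X Y : iso X Y -> iso (F X) (F Y).
Proof.
by move=> [f [g [gf fg]]]; exists (Fm f), (Fm g); rewrite -!FmC gf fg !Fm1.
Qed.

Lemma F_idsum X Y : idsum X Y -> idsum (F X) (F Y).
Proof.
move=> [l e]; exists [seq (Fm x.1, Fm x.2) | x <- l].
rewrite -Fm1 e Fm_sum big_map; apply: eq_bigr => x _.
by rewrite FmC.
Qed.

Lemma F_bip X Y : iso (F (X ⊕ Y)) (bip (F X) (F Y)).
Proof.
exists (mpair (Fm (pr1 X Y)) (Fm (pr2 X Y))), (mcopair (Fm (in1 X Y)) (Fm (in2 X Y))).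
split; first by rewrite mcopair_mpair -!FmC -FmD bip_id Fm1.
apply: bip_ext_in; apply: bip_ext_pr;
  rewrite comp1m -compA ?mcopair_in1 ?mcopair_in2 compA
    ?pr1_mpair ?pr2_mpair -FmC ?(pr1_in1, pr2_in2, pr1_in2, pr2_in1);
  by rewrite ?Fm1 ?Fm0.
Qed.

Lemma F_zero X : idm X = 0 -> idm (F X) = 0.
Proof. by rewrite -Fm1 => ->; apply: Fm0. Qed.

Lemma F_cpow X r : iso (F (cpow X r)) (cpow (F X) r).
Proof.
elim: r => [|r IH] /=.
  by apply: zero_iso; [apply: F_zero; apply: zobP | apply: zobP].
exact: iso_trans (F_bip _ _) (iso_bip (iso_refl _) IH).
Qed.

Lemma F_faithful A Y (a b : Hom A Y) : idsum T A -> Fm a = Fm b -> a = b.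
Proof.
move=> [l e] ab; rewrite -[a]compm1 -[b]compm1 e !comp_sumr.
apply: eq_bigr => x _; rewrite !compA; congr (_ ∘ _).
by rewrite -!FmE ab.
Qed.

Lemma F_faithful0 A Y (a : Hom A Y) : idsum T A -> Fm a = 0 -> a = 0.
Proof. by move=> TA; rewrite -(Fm0 A Y); apply: F_faithful. Qed.

(** Over an object of [add T], a homomorphism is determined by its values on the
    finitely many maps [T -> A] that occur in [idsum T A]. *)
Lemma F_full_proj A Y (phi : Hom (F A) (F Y)) : idsum T A -> exists a, phi = Fm a.
Proof.
move=> [l e]; exists (\sum_(x <- l) (phi @@ x.1 : Hom T Y) ∘ x.2).
apply: mext => u; rewrite FmE -{1}[u : Hom T A]comp1m e !comp_suml mlin_sum.
apply: eq_bigr => x _; rewrite -!compA.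
exact: (mact phi x.1 (x.2 ∘ u)).
Qed.

Lemma F_dual A : idsum T A -> dual_basis (F A).
Proof.
move=> [l e]; exists [seq (x.1 : homT T A, Fm x.2) | x <- l] => u.
rewrite big_map -{1}[u : Hom T A]comp1m e comp_suml.
by apply: eq_bigr => x _; rewrite -compA /= FmE.
Qed.

Lemma dual_idsum (P : mods) : dual_basis P -> idsum (F T) P.
Proof.
move=> [l lP].
have actx (x : (P : rmod _)) : exists p : Hom (F T) P, forall a, p @@ a = act x a.
  have [p pE] := mouter1 x (idm (regm (endalg T) : mods)).
  by exists p => a; rewrite pE mapp1.
have [p pE] := fun_choice actx.
exists [seq (p b.1, b.2 : Hom P (F T)) | b <- l].
apply: mext => x; rewrite mapp1 big_map mapp_sum {1}[x]lP.
by apply: eq_bigr => b _; rewrite mappC pE.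
Qed.

Hypothesis C_split : split_idempotents C.

(** A projective module is a retract of some [F (T^r)]; the corresponding
    idempotent comes from an idempotent of [T^r], which splits. *)
Lemma projective_F (P : mods) : projective P ->
  exists2 A, idsum T A & iso (F A) P.
Proof.
move=> /projectiveP/dual_idsum/sum_through_cpow [r [p [i /esym pi1]]].
have [c [c' [c'c cc']]] := F_cpow T r.
have TA := idsum_cpow T r.
have [e eE] := F_full_proj (c' ∘ i ∘ p ∘ c) TA.
have ee : e ∘ e = e.
  apply: F_faithful => //; rewrite FmC -eE !compA -(compA _ c c') cc' compm1.
  by rewrite -(compA _ p i) pi1 compm1.
have [A [r' [s [sr rs]]]] := C_split ee.
exists A; first by apply: idsum_retract TA; exists s, r'.
exists (p ∘ c ∘ Fm s), (Fm r' ∘ c' ∘ i); split.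
  have -> : Fm r' ∘ c' ∘ i ∘ (p ∘ c ∘ Fm s) = Fm r' ∘ (c' ∘ i ∘ p ∘ c) ∘ Fm s.
    by rewrite !compA.
  by rewrite eE -!FmC -sr !compA rs comp1m rs Fm1.
rewrite !compA -(compA _ (Fm s)) -FmC sr -eE !compA -(compA p) cc' compm1 pi1.
by rewrite comp1m -(compA p) cc' compm1 pi1.
Qed.

End Functor.

(** * Relative rigidity and tau *)

Section Relative.
Variables (k : fieldType) (C : lincat k) (C_split : split_idempotents C).
Variables (m : nat) (S : angulation C m.+1) (T : C) (T_ct : cluster_tilting S T).
Local Notation mods := (modcat (endalg T)).
Local Notation F X := (homT T X : mods).
Implicit Types X Y Z A B : C.

Definition rel0 X Y : Prop := ideal0 (S T) X (S Y).

Lemma rel0P X Y :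
  rel0 X Y <-> forall (h : Hom X (S T)) (g : Hom T Y), amor S g ∘ h = 0.
Proof.
split=> [/(ideal0P C_split) H h g|H]; first exact: H.
by apply/(ideal0P C_split) => h g; have [g' <-] := amor_surj g.
Qed.

Lemma no_ext A B (f : Hom A (S B)) : idsum T A -> idsum T B -> f = 0.
Proof.
move=> [l e] [l' e']; rewrite -[f]compm1 e comp_sumr big1 // => x _.
rewrite -[f]comp1m -amor_id e' raddf_sum !comp_suml big1 // => y _.
transitivity (amor S y.1 ∘ (amor S y.2 ∘ f ∘ x.1) ∘ x.2).
  by rewrite amor_comp !compA.
by rewrite (T_ct.1 (_ ∘ x.1)) compm0 comp0m.
Qed.

(** A sequence in [add T] over [Z] that [F] turns into the beginning of a projective
    resolution of [F Z]. *)
Fixpoint add_res j {X Z} : seqn j X Z -> Prop :=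
  match j with
  | 0 => fun d => idsum T X /\ forall u : Hom T Z, exists v, u = d ∘ v
  | j'.+1 => fun s => [/\ idsum T X,
      exact_pair (projT2 s).1 (shd (projT2 s).2) & add_res (projT2 s).2]
  end.

Lemma add_resI j X Z (q : seqn j X Z) :
  idsum T X -> smid_all (addob T) q -> (forall i, (i < j)%N -> exact_at i q) ->
  (forall u : Hom T Z, exists v, u = projT2 (slast q) ∘ v) -> add_res q.
Proof.
elim: j X q => [|j IH] X q TX //= [TY qT] qe ql; split=> //.
  exact: (qe 0%N).
by apply: IH => //; [exact: addob_idsum | move=> i; apply: (qe i.+1)].
Qed.

Lemma add_res_last j X Z (q : seqn j X Z) : add_res q ->
  idsum T (projT1 (slast q)) /\
  forall u : Hom T Z, exists v, u = projT2 (slast q) ∘ v.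
Proof. by elim: j X q => [|j IH] X q //= [_ _]; apply: IH. Qed.

Lemma add_res_last2 j X Z (q : seqn j.+1 X Z) : add_res q ->
  exists A (p : Hom A (projT1 (slast q))),
    idsum T A /\ exact_pair p (projT2 (slast q)).
Proof.
elim: j X q => [|j IH] X q [TX qe qT]; first by exists X, (projT2 q).1.
exact: IH qT.
Qed.

Lemma add_res_head j X Z (q : seqn j X Z) : add_res q -> idsum T X.
Proof. by case: j q => [|j] q []. Qed.

Lemma exact_pair_scale X Y Z c (f : Hom X Y) (g : Hom Y Z) : c != 0 ->
  exact_pair f (c *: g) -> exact_pair f g.
Proof.
move=> c0 [gf cov con]; split.
- by apply: (scalerI c0); rewrite -compZl gf scaler0.
- by move=> W u gu; apply: cov; rewrite compZl gu scaler0.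
by move=> W u /con [v ->]; exists (c *: v); rewrite compZl compZr.
Qed.

(** Exactness at [S T0] is read off the rotated angle, whose last map is
    [S d] up to sign. *)
Lemma approximation X : exists T0 (q : seqn m.+1 T0 X) (h : Hom X (S T0)),
  [/\ add_res q, exact_pair (projT2 (slast q)) h & exact_pair h (amor S (shd q))].
Proof.
have [T0 [q [h [aq /addob_idsum TT0 qT]]]] := T_ct.2 X.
have e j (lej : (j <= m.+1)%N) := angle_exact aq lej.
have qh := exact_at_last (e m.+1 (leqnn _)).
exists T0, q, h; split=> //.
  apply: add_resI => // [i lti|u].
    by apply: (exact_at_prefix (h := h)) => //; apply: e; apply: ltnW.
  by have [_ cov _] := qh; apply: cov; apply: no_ext => //; apply: idsum_refl.
case: q aq {qT e qh} => T1 [d0 q] aq.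
have ar := (angle_rotate d0 (srcons q h)).1 aq.
have := exact_at_last (angle_exact ar (leqnn _)).
rewrite slast_srcons; apply: exact_pair_scale.
by rewrite signr_eq0.
Qed.

(** [F] is bijective on maps out of [add T], and a map out of [X] is controlled by
    its composite with the last map [B -> X] of a resolution, which [F] makes
    surjective. *)
Lemma F_full X Y (phi : Hom (F X) (F Y)) : exists a, phi = Fm T a.
Proof.
have [T0 [q [h [qT _ _]]]] := approximation X.
have [TB Bsurj] := add_res_last qT; have [A [p [TA [lp _ con]]]] := add_res_last2 qT.
move: (slast q) TB Bsurj p lp con => [B l] /= TB Bsurj p lp con.
have [b bE] := F_full_proj (phi ∘ Fm T l) TB.
have [a ba] : exists a, b = a ∘ l.
  apply: con; apply: (F_faithful0 TA).
  by rewrite FmC -bE -compA -FmC lp Fm0 compm0.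
exists a; apply: (@mext _ _ (F X) (F Y)) => u; have [v ->] := Bsurj u.
by rewrite -(FmE l) -!mappC bE -FmC ba.
Qed.

Lemma F_kernel X Y (a : Hom X Y) : Fm T a = 0 ->
  exists Z (h : Hom X (S Z)) v, idsum T Z /\ a = v ∘ h.
Proof.
move=> Fa; have [T0 [q [h [qT [_ _ con] _]]]] := approximation X.
have [TB _] := add_res_last qT; exists T0, h.
have [v av] : exists v, a = v ∘ h.
  by apply: con; apply: (F_faithful0 TB); rewrite FmC Fa comp0m.
by exists v; split=> //; apply: add_res_head qT.
Qed.

(** Maps [X -> S T] factor through [h], and [S u h = 0] means that [u] extends along
    the first map of the resolution. *)
Lemma rel0_factor X Y T0 (q : seqn m.+1 T0 X) (h : Hom X (S T0)) :
  add_res q -> exact_pair (projT2 (slast q)) h -> exact_pair h (amor S (shd q)) ->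
  rel0 X Y <-> forall u : Hom T0 Y, exists v, u = v ∘ shd q.
Proof.
move=> qT [_ _ con] [dh _ con']; have [TB _] := add_res_last qT.
have TT0 := add_res_head qT; split=> [/rel0P H u|H].
  have uh : amor S u ∘ h = 0.
    have [l e] := TT0; rewrite -[u]compm1 e comp_sumr raddf_sum comp_suml.
    rewrite big1 // => x _; rewrite compA amor_comp -compA.
    exact: H.
  have [v' uv'] := con' _ _ uh; have [v vE] := amor_surj v'.
  by exists v; apply: (amor_inj (S := S)); rewrite uv' -vE amor_comp.
apply/rel0P => g a; have [b gb] : exists b, g = b ∘ h.
  by apply: con; apply: no_ext => //; apply: idsum_refl.
have [b' bE] := amor_surj b; have [v vE] := H (a ∘ b').
by rewrite gb -bE compA -amor_comp vE amor_comp -compA dh compm0.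
Qed.

(** The differentials of a minimal resolution together with the augmentation,
    indexed by the degree of the source. *)
Definition res_target (M : mods) (R : minres M) i : mods :=
  if i is j.+1 then res R j else M.

Definition res_map (M : mods) (R : minres M) i :
    Hom (res R i : mods) (res_target R i) :=
  match i with
  | 0 => vsproj (mhom (res R 0) M) (res_aug R)
  | j.+1 => vsproj (mhom (res R j.+1) (res R j)) (res_d R j)
  end.

Lemma res_map0E (M : mods) (R : minres M) x : res_map R 0 @@ x = res_aug R x.
Proof. by rewrite /mapp vsprojK // res_aug_mhom. Qed.

Lemma res_mapSE (M : mods) (R : minres M) i x : res_map R i.+1 @@ x = res_d R i x.
Proof. by rewrite /mapp vsprojK // res_d_mhom. Qed.

Lemma res_map_exact (M : mods) (R : minres M) i : mexact (res_map R i.+1) (res_map R i).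
Proof.
move=> x; have -> : (res_map R i @@ x = 0) <-> x \in limg (res_d R i).
  case: i x => [|i] x; rewrite ?res_exact0 ?res_exact memv_ker.
    by rewrite res_map0E; split=> [->|/eqP].
  by rewrite res_mapSE; split=> [->|/eqP].
split=> [[y <-]|/memv_imgP [y _ ->]]; last by exists y; rewrite res_mapSE.
by rewrite res_mapSE memv_img ?memvf.
Qed.

Lemma res_map_min (M : mods) (R : minres M) i :
  superfluous (lker (vsval (res_map R i : mh _ _))).
Proof.
case: i => [|i]; rewrite vsprojK ?res_aug_mhom ?res_d_mhom //.
  exact: res_min0.
exact: res_min.
Qed.

Lemma F_exact X Y Z (f : Hom X Y) (g : Hom Y Z) :
  exact_pair f g -> mexact (Fm T f) (Fm T g).
Proof.
move=> [gf cov _] x; rewrite FmE; split=> [[y <-]|/cov [y ->]].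
  by rewrite FmE compA gf comp0m.
by exists y; rewrite FmE.
Qed.

Lemma resolutions_compared X (M : mods) (R : minres M) : iso (F X) M ->
  (forall j A (q : seqn j A X), add_res q ->
     comparable (Fm T (shd q)) (res_map R j)) /\
  (forall j A (q : seqn j.+1 A X), add_res q ->
     compared (Fm T (shd q)) (res_map R j.+1)).
Proof.
move=> XM; have Rdual i : dual_basis (res R i : mods) by apply/projectiveP/res_proj.
have step j A (q : seqn j.+1 A X) : add_res q ->
    comparable (Fm T (shd (projT2 q).2)) (res_map R j) ->
    compared (Fm T (shd q)) (res_map R j.+1).
  move=> [TA e qT] cmp; have TB := add_res_head qT.
  apply: comparison_step cmp _ _ _ _ _ _ => //; try exact: F_dual.
  - exact: F_exact.
  - exact: res_map_exact.
  - exact: res_map_min.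
have all j A (q : seqn j A X) : add_res q -> comparable (Fm T (shd q)) (res_map R j).
  elim: j A q => [|j IH] A q qT; last first.
    by apply: compared_comparable; apply: step => //; case: qT => _ _ /IH.
  case: qT => TA qs; apply: comparable_cover => //; first exact: F_dual.
  - by move=> u; have [v ->] := qs u; exists v; rewrite FmE.
  - move=> y; have : y \in limg (res_aug R) by rewrite res_aug_surj memvf.
    by move=> /memv_imgP [x _ ->]; exists x; rewrite res_map0E.
  exact: res_map_min.
split=> // j A q qT; apply: step => //; case: qT => _ _; exact: all.
Qed.

(** These are the objects on which [F] loses no information up to isomorphism. *)
Definition susp_free X : Prop := forall W, idsum (S T) W -> retract W X -> idm W = 0.

Lemma susp_free_disjoint X W : susp_free X -> idsum (S T) W -> disjoint W X.
Proof. by move=> fX TW V VW VX; apply: fX => //; apply: idsum_retract TW. Qed.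

(** Both sides say that every map from the first term of a
    resolution to the module factors through the next one: the left one for the
    resolution given by an angle, the right one for a minimal resolution.
    That [X] has no summand in [add (S T)] means that the former has no redundant
    summand in its first term: an endomorphism of [T0] that [T0 -> T1] annihilates
    suspends to a map factoring through [X]. *)
Lemma rel0_tau X Y (M N : mods) : susp_free X -> iso (F X) M -> iso (F Y) N ->
  rel0 X Y <-> Hom0 N (tau m.+1 M).
Proof.
move=> fX XM [t [t' [t't tt']]]; rewrite /Hom0; have [R ->] := hom_tau N M m.
have [T0 [q [h [qT lh hd]]]] := approximation X; rewrite (rel0_factor _ qT lh hd).
have cmp := (resolutions_compared R XM).2 _ _ _ qT; have TT0 := add_res_head qT.
have -> : (forall f : Hom (res R m.+1 : mods) N, exists g, forall x,
    f @@ x = g @@ res_d R m x) <-> (forall f : Hom (res R m.+1 : mods) N,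
    exists g, f = g ∘ res_map R m.+1).
  split=> H f; have [g fg] := H f; exists g.
    by apply: mext => x; rewrite fg mappC res_mapSE.
  by move=> x; rewrite fg mappC res_mapSE.
have -> : (forall u : Hom T0 Y, exists v, u = v ∘ shd q) <->
    (forall u : Hom (F T0) N, exists v, u = v ∘ Fm T (shd q)).
  split=> H u.
    have [a aE] := F_full_proj (t' ∘ u) TT0; have [v vE] := H a.
    exists (t ∘ Fm T v); rewrite -compA -FmC -vE -aE compA tt' comp1m.
    by [].
  have [v vE] := H (t ∘ Fm T u); have [a aE] := F_full (t' ∘ v).
  exists a; apply: (F_faithful TT0); rewrite FmC -aE -compA -vE compA t't.
  by rewrite comp1m.
split; first exact: compared_factor.
apply: factor_compared cmp _ => phi dphi.
have [a aE] := F_full_proj phi TT0.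
have da : amor S (shd q) ∘ amor S a = 0.
  rewrite -amor_comp; suff -> : shd q ∘ a = 0 by rewrite raddf0.
  by apply: (F_faithful0 TT0); rewrite FmC -aE.
have [_ cov _] := hd; have [b ab] := cov _ _ da.
have dis : disjoint (S T0) X by apply: susp_free_disjoint => //; apply/idsum_susp.
have [c [_ ac]] := disjoint_unit C_split (- b) h dis.
have [c' cE] := amor_surj c; exists (Fm T c').
rewrite aE -Fm1 -FmD -FmC; congr Fm; apply: (amor_inj (S := S)).
by rewrite amor_comp raddfD amor_id ab cE -[RHS]ac compNr opprK.
Qed.

End Relative.

(** * Decompositions and bijections *)

Section BiproductIso.
Variables (k : fieldType) (C : lincat k).
Implicit Types X Y Z W M : C.

Lemma bip_swap X Y : iso (X ⊕ Y) (Y ⊕ X).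
Proof.
have swK (A B : C) : mpair (pr2 A B) (pr1 A B) ∘ mpair (pr2 B A) (pr1 B A) = idm _.
  by apply: bip_ext_pr; rewrite compA ?pr1_mpair ?pr2_mpair compm1
    ?pr1_mpair ?pr2_mpair.
by exists (mpair (pr2 X Y) (pr1 X Y)), (mpair (pr2 Y X) (pr1 Y X)); split; apply: swK.
Qed.

Lemma retract_bip X Y X' Y' :
  retract X X' -> retract Y Y' -> retract (X ⊕ Y) (X' ⊕ Y').
Proof.
move=> [s [r rs]] [s' [r' rs']].
exists (mcopair (in1 X' Y' ∘ s) (in2 X' Y' ∘ s')).
exists (mcopair (in1 X Y ∘ r) (in2 X Y ∘ r')).
apply: bip_ext_in;
by rewrite -compA ?mcopair_in1 ?mcopair_in2 compA ?mcopair_in1 ?mcopair_in2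
  -compA ?(rs, rs') compm1 comp1m.
Qed.

Lemma sum_through_bip X Y Z W (f : Hom Z W) : sum_through (X ⊕ Y) f ->
  exists a b, [/\ f = a + b, sum_through X a & sum_through Y b].
Proof.
move=> [l ->]; elim: l => [|x l [a [b [e Xa Yb]]]].
  by exists 0, 0; rewrite big_nil addr0; split=> //; apply: sum_through0.
exists (x.1 ∘ in1 X Y ∘ (pr1 X Y ∘ x.2) + a).
exists (x.1 ∘ in2 X Y ∘ (pr2 X Y ∘ x.2) + b).
split; try by apply: sum_throughD => //; apply: sum_through1.
by rewrite big_cons e bip_decomp addrACA.
Qed.

Lemma idsum_retract_gen M N X : retract M N -> idsum M X -> idsum N X.
Proof. by move=> MN; apply: idsum_trans; apply: idsum_retract MN (idsum_refl N). Qed.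

Lemma idsum_iso M N X Y : iso M N -> iso X Y -> idsum M X <-> idsum N Y.
Proof.
move=> MN XY; split=> H.
  apply: idsum_retract (iso_retract (iso_sym XY)) _.
  exact: idsum_retract_gen (iso_retract MN) H.
apply: idsum_retract (iso_retract XY) _.
exact: idsum_retract_gen (iso_retract (iso_sym MN)) H.
Qed.

Lemma idsum_zero M X : idm X = 0 -> idsum M X.
Proof. by move=> X0; rewrite /idsum X0; apply: sum_through0. Qed.

Lemma zero_hom_idsum M X Y : idsum M X ->
  (forall f : Hom M Y, f = 0) -> forall f : Hom X Y, f = 0.
Proof.
move=> [l e] H f; rewrite -[f]compm1 e comp_sumr big1 // => x _.
by rewrite compA (H (f ∘ x.1)) comp0m.
Qed.

Lemma zero_hom_retract X X' Y Y' : retract X X' -> retract Y Y' ->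
  (forall f : Hom X' Y', f = 0) -> forall f : Hom X Y, f = 0.
Proof.
move=> [s [r rs]] [s' [r' rs']] H f.
transitivity (r' ∘ (s' ∘ f ∘ r) ∘ s).
  by rewrite !compA rs' comp1m -compA rs compm1.
by rewrite (H (s' ∘ f ∘ r)) compm0 comp0m.
Qed.

Lemma addob_idsumP (split : split_idempotents C) M X : addob M X <-> idsum M X.
Proof. by split; [apply: addob_idsum | apply: idsum_addob]. Qed.

End BiproductIso.

Section Bijections.
Variables (k : fieldType) (C : lincat k) (C_split : split_idempotents C).
Variables (m : nat) (S : angulation C m.+1) (T : C) (T_ct : cluster_tilting S T).
Local Notation mods := (modcat (endalg T)).
Local Notation F X := (homT T X : mods).
Local Notation rel0 := (rel0 S T).
Local Notation susp_free := (susp_free S T).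
Implicit Types X Y Z W A B M : C.

Lemma susp_idsum A : idsum T A -> idsum (S T) (S A).
Proof. by move=> TA; apply/idsum_susp. Qed.

Lemma susp_idsum_inv W : idsum (S T) W -> exists2 A, idsum T A & S A = W.
Proof.
move=> TW; have [A e] := susp_surj S W.
by exists A; rewrite // -(idsum_susp S) e.
Qed.

Lemma susp_free_bip X Y : susp_free X -> susp_free Y -> susp_free (X ⊕ Y).
Proof.
move=> fX fY W TW WXY; apply: fY => //; apply: disjoint_cancel WXY => //.
exact: (susp_free_disjoint fX TW).
Qed.

Lemma susp_free_zero X : idm X = 0 -> susp_free X.
Proof. by move=> X0 W _ /zero_retract; apply. Qed.

Lemma susp_free_cpow X r : susp_free X -> susp_free (cpow X r).
Proof.
move=> fX; elim: r => [|r IH] /=; last exact: susp_free_bip.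
by apply: susp_free_zero; apply: zobP.
Qed.

(** On [W] the identity is [a + b] with [a] through a power of [X] and [b] a sum of
    maps through [B]; so [b = 1 - a] is invertible. *)
Lemma idsum_free_cancel X B W : susp_free X -> idsum (S T) W ->
  idsum (X ⊕ B) W -> idsum B W.
Proof.
move=> fX TW /sum_through_bip [a [b [e Xa Bb]]].
have [r [g [h agh]]] := sum_through_cpow Xa.
have dis := susp_free_disjoint (susp_free_cpow (r := r) fX) TW.
have [c [cb _]] := disjoint_unit C_split h g dis.
rewrite /idsum -cb -agh e addrAC subrr add0r -[c ∘ b]compm1.
exact: sum_through_comp.
Qed.

(** ** Reflection along [F] *)

(** [u - 1] lies in the kernel of [F], so it factors through [add (S T)], whose
    objects are disjoint from [X]. *)
Lemma susp_free_unit X (u : Hom X X) : susp_free X -> Fm T u = Fm T (idm X) -> is_iso u.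
Proof.
move=> fX Fu; have [|Z [h [v [TZ e]]]] := F_kernel T_ct (a := u - idm X).
  by rewrite FmB Fu subrr.
have -> : u = idm X - (- v) ∘ h by rewrite compNl opprK -e addrC subrK.
apply: disjoint_unit => //; apply: disjoint_sym.
exact: (susp_free_disjoint fX (susp_idsum TZ)).
Qed.

Lemma lift_sum_through X Y M (f : Hom (F X) (F Y)) : sum_through (F M) f ->
  exists2 u : Hom X Y, f = Fm T u & sum_through M u.
Proof.
move=> [l ->]; elim: l => [|[p i] l [u fu Mu]].
  by exists 0; [rewrite big_nil Fm0 | apply: sum_through0].
have [p' pE] := F_full T_ct (p : Hom (F M) (F Y)).
have [i' iE] := F_full T_ct (i : Hom (F X) (F M)).
exists (p' ∘ i' + u); last exact/sum_throughD/Mu/sum_through1.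
by rewrite big_cons fu FmD FmC -pE -iE.
Qed.

Lemma reflect_idsum_free X M : susp_free X -> idsum (F M) (F X) -> idsum M X.
Proof.
move=> fX; rewrite /idsum -Fm1 => /lift_sum_through [u uE Mu].
have [c [cu _]] := susp_free_unit fX (esym uE).
by rewrite -cu -[c ∘ u]compm1; apply: sum_through_comp.
Qed.

Lemma reflect_idsum_proj A B : idsum T A -> idsum (F B) (F A) -> idsum B A.
Proof.
move=> TA; rewrite /idsum -Fm1 => /lift_sum_through [u uE Mu].
by rewrite (F_faithful TA uE).
Qed.

Lemma reflect_iso_free X Y : susp_free X -> susp_free Y -> iso (F X) (F Y) -> iso X Y.
Proof.
move=> fX fY [f [g [gf fg]]].
have [a aE] := F_full T_ct f; have [b bE] := F_full T_ct g.
have [|c [cba _]] := @susp_free_unit X (b ∘ a) fX; first by rewrite FmC -aE -bE Fm1.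
have [|c' [_ abc]] := @susp_free_unit Y (a ∘ b) fY; first by rewrite FmC -aE -bE Fm1.
exists a, (c ∘ b); split; first by rewrite -compA.
have -> : c ∘ b = b ∘ c'.
  by apply: (@inverse_unique _ _ _ _ a); [rewrite -compA | rewrite compA].
by rewrite compA.
Qed.

Lemma reflect_iso_proj A B : idsum T A -> idsum T B -> iso (F A) (F B) -> iso A B.
Proof.
move=> TA TB [f [g [gf fg]]].
have [a aE] := F_full_proj f TA; have [b bE] := F_full_proj g TB.
exists a, b; split; [apply: (F_faithful TA) | apply: (F_faithful TB)];
  by rewrite FmC -aE -bE Fm1.
Qed.

Lemma F_susp_zero A : idsum T A -> idm (F (S A)) = 0.
Proof.
move=> TA; apply: mext => u; rewrite mapp1 mapp0.
by apply: (no_ext T_ct) => //; apply: idsum_refl.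
Qed.

(** ** Decompositions *)

Definition susp_decomp M M0 A : Prop :=
  [/\ susp_free M0, idsum T A & iso M (M0 ⊕ S A)].

(** Maximality of the summand [S A] is the absence of summands of [M0] in
    [add (S T)]: a summand [W] of [M0] would enlarge [S A] to [S A + W], and
    conversely a larger summand [Z] of [M0 + S A] has nothing in common with [M0],
    so it is a retract of [S A]. *)
Lemma max_decompositionP M M0 A : max_decomposition S T M M0 A <-> susp_decomp M M0 A.
Proof.
split=> [[/addob_idsum TA iM max]|[fM0 TA iM]].
  split=> // W TW WM0; apply: (iso_bip_zero (X := S A)); apply: max.
  - by apply: idsum_addob => //; apply: idsum_bip => //; apply: susp_idsum.
  - apply: retract_summand => //; apply: retract_trans (iso_retract (iso_sym iM)).
    apply: retract_trans (iso_retract (bip_swap _ _)).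
    by apply: retract_bip => //; apply: iso_retract; apply: iso_refl.
  by apply: retract_summand => //; apply: retract_in1.
split=> //; first exact: idsum_addob.
move=> Z /addob_idsum TZ /summand_retract ZM /summand_retract AZ.
apply: retract_antisym => //.
apply: (@disjoint_cancel _ _ C_split _ M0); first exact: (susp_free_disjoint fM0 TZ).
exact: retract_trans ZM (iso_retract iM).
Qed.

(** Choose the summand [S A] so that the dimension of its endomorphism algebra is
    maximal; that of [M] is an upper bound. *)
Lemma susp_decomp_exists M : exists M0 A, susp_decomp M M0 A.
Proof.
pose d B := \dim {: Hom (S B) (S B)}.
have [|A [TA AM] Amax] := @ex_minimizer C (fun B => idsum T B /\ retract (S B) M)
  (fun B => \dim {: Hom M M} - d B)%N.
  exists (zob C); split; first exact/idsum_zero/zobP.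
  by apply: retract_zero; apply/amor_zero/zobP.
have [M0 iM] := retract_summand C_split AM; exists M0, A; split=> //; last first.
  exact: iso_trans (iso_sym iM) (bip_swap _ _).
move=> W TW WM0; have [B TB eB] := susp_idsum_inv TW; rewrite -{}eB in TW WM0 *.
have ABM : retract (S (A ⊕ B)) M.
  apply: retract_trans (iso_retract iM); apply: retract_trans (retract_bip _ WM0).
    by apply: iso_retract; apply: iso_sym; apply: susp_bip.
  exact: iso_retract (iso_refl _).
have := Amax _ (conj (idsum_bip TA TB) ABM).
rewrite (leq_sub2lE _ (retract_dim ABM)) => le_d.
apply: (iso_bip_zero (X := S A)); apply: iso_trans (susp_bip S A B) _.
by apply: iso_sym; apply: retract_iso => //; apply/susp_retract; apply: retract_in1.
Qed.

Lemma susp_decomp_F M M0 A : susp_decomp M M0 A -> iso (F M) (F M0).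
Proof.
move=> [_ TA iM]; apply: iso_trans (F_iso T iM) _.
apply: iso_trans (F_bip T M0 (S A)) _.
have z := F_susp_zero TA.
apply: iso_sym; exists (in1 (F M0) (F (S A))), (pr1 (F M0) (F (S A))).
split; first exact: pr1_in1.
rewrite -[RHS]bip_id [in2 _ _ ∘ _](_ : _ = 0) ?addr0 //.
by rewrite (zero_to (pr2 _ _) z) compm0.
Qed.

(** An isomorphism [M = N] makes [S A] and [S B] retracts of each other, since
    [S A] has no summand in common with [N0]; on [M0] and [N0] it is only visible
    after applying [F], and [F] reflects isomorphisms there. *)
Lemma susp_decomp_iso M M0 A N N0 B : susp_decomp M M0 A -> susp_decomp N N0 B ->
  iso M N <-> iso (F M0) (F N0) /\ iso (F A) (F B).
Proof.
move=> dM dN; have [fM0 TA iM] := dM; have [fN0 TB iN] := dN.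
have sub X X0 B1 B2 : susp_free X0 -> idsum T B1 -> iso X (X0 ⊕ S B2) ->
    retract (S B1) X -> retract (S B1) (S B2).
  move=> fX0 TB1 iX B1X; apply: (@disjoint_cancel _ _ C_split _ X0).
    exact: (susp_free_disjoint fX0 (susp_idsum TB1)).
  exact: retract_trans B1X (iso_retract iX).
split=> [iMN|[iF0 iFA]].
  split.
    apply: iso_trans (iso_sym (susp_decomp_F dM)) _.
    exact: iso_trans (F_iso T iMN) (susp_decomp_F dN).
  apply: F_iso; apply/(susp_iso S); apply: retract_antisym.
    apply: (sub _ _ _ _ fN0 TA iN); apply: retract_trans (iso_retract iMN).
    exact: retract_trans (retract_in2 _ _) (iso_retract (iso_sym iM)).
  apply: (sub _ _ _ _ fM0 TB iM); apply: retract_trans (iso_retract (iso_sym iMN)).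
  exact: retract_trans (retract_in2 _ _) (iso_retract (iso_sym iN)).
apply: iso_trans iM _; apply: iso_trans (iso_sym iN).
apply: iso_bip; first exact: reflect_iso_free.
by apply/susp_iso; apply: reflect_iso_proj.
Qed.

End Bijections.

Section Pairs.
Variables (k : fieldType) (C : lincat k) (C_split : split_idempotents C).
Variables (m : nat) (S : angulation C m.+1) (T : C) (T_ct : cluster_tilting S T).
Local Notation mods := (modcat (endalg T)).
Local Notation F X := (homT T X : mods).
Local Notation rel0 := (rel0 S T).
Local Notation susp_free := (susp_free S T).
Local Notation susp_decomp := (susp_decomp S T).
Local Notation tau := (tau m.+1).
Implicit Types X Y Z W A B M : C.
Implicit Types p : mod_pair T.
Implicit Types N Q : mods.

(** ** The relation [rel0] *)

Lemma rel0_retract X Y X' Y' : retract X X' -> retract Y Y' -> rel0 X' Y' -> rel0 X Y.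
Proof.
move=> [s [r rs]] [s' [r' rs']] /(rel0P C_split) H; apply/(rel0P C_split) => h g.
transitivity (amor S r' ∘ (amor S (s' ∘ g) ∘ (h ∘ r)) ∘ s).
  by rewrite !compA -amor_comp compA rs' comp1m -!compA rs compm1.
by rewrite H compm0 comp0m.
Qed.

Lemma rel0_bip_l X X' Y : rel0 (X ⊕ X') Y <-> rel0 X Y /\ rel0 X' Y.
Proof.
split=> [H|[/(rel0P C_split) H /(rel0P C_split) H']].
  by split; apply: rel0_retract H;
    [apply: retract_in1 | apply: iso_retract; apply: iso_refl
    |apply: retract_in2 | apply: iso_retract; apply: iso_refl].
apply/(rel0P C_split) => h g; apply: bip_ext_in; rewrite comp0m -compA;
by rewrite ?(H, H').
Qed.

Lemma rel0_bip_r X Y Y' : rel0 X (Y ⊕ Y') <-> rel0 X Y /\ rel0 X Y'.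
Proof.
split=> [H|[/(rel0P C_split) H /(rel0P C_split) H']].
  by split; apply: rel0_retract H;
    [apply: iso_retract; apply: iso_refl | apply: retract_in1
    |apply: iso_retract; apply: iso_refl | apply: retract_in2].
apply/(rel0P C_split) => h g.
transitivity (amor S (in1 Y Y') ∘ (amor S (pr1 Y Y' ∘ g) ∘ h) +
              amor S (in2 Y Y') ∘ (amor S (pr2 Y Y' ∘ g) ∘ h)).
  rewrite !(compA _ _ h) -!amor_comp -compDl -raddfD; congr (amor S _ ∘ h).
  by rewrite !compA -compDl bip_id comp1m.
by rewrite H H' !compm0 addr0.
Qed.

Lemma rel0_bip X Y : rel0 (X ⊕ Y) (X ⊕ Y) <->
  [/\ rel0 X X, rel0 X Y, rel0 Y X & rel0 Y Y].
Proof. by rewrite rel0_bip_l !rel0_bip_r; split=> [[[? ?] [? ?]]|[]]. Qed.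

Lemma rel0_iso X Y X' Y' : iso X X' -> iso Y Y' -> rel0 X Y <-> rel0 X' Y'.
Proof.
by move=> XX' YY'; split; apply: rel0_retract; apply: iso_retract => //; apply: iso_sym.
Qed.

Lemma rel0_susp_r X A : idsum T A -> rel0 X (S A).
Proof.
move=> TA; apply/(rel0P C_split) => h g.
by rewrite (no_ext T_ct g) ?raddf0 ?comp0m //; apply: idsum_refl.
Qed.

Lemma Hom0P N Q : Hom0 N Q <-> forall f : Hom N Q, f = 0.
Proof. exact: mhom0P. Qed.

Lemma Hom0_retract N N' Q Q' : retract N N' -> retract Q Q' ->
  Hom0 N' Q' -> Hom0 N Q.
Proof. by move=> rN rQ /Hom0P H; apply/Hom0P; apply: zero_hom_retract H. Qed.

(** [rel0 (S A) Y] says that the composites [A -> T -> Y] vanish; they generate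
    [C(A, Y)]. *)
Lemma rel0_susp_l A Y N Q : idsum T A -> iso (F A) Q -> iso (F Y) N ->
  rel0 (S A) Y <-> Hom0 Q N.
Proof.
move=> TA AQ YN; transitivity (forall f : Hom A Y, f = 0).
  split=> [/(rel0P C_split) H f|H].
    have [l e] := TA; rewrite -[f]compm1 e comp_sumr big1 // => x _.
    apply: (amor_inj (S := S)); rewrite compA amor_comp H.
    by rewrite raddf0.
  apply/(rel0P C_split) => h g; have [h' <-] := amor_surj h.
  by rewrite -amor_comp (H (g ∘ h')) raddf0.
transitivity (Hom0 (F A) (F Y)).
  split=> [H|/Hom0P H f].
    by apply/Hom0P => f; have [a ->] := F_full_proj f TA; rewrite (H a) Fm0.
  exact: (F_faithful0 TA (H (Fm T f))).
by split; apply: Hom0_retract; apply: iso_retract => //; apply: iso_sym.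
Qed.

(** ** One object and its pair *)

Section OnePair.
Variables (M M0 A : C) (N Q : mods).
Hypotheses (dM : susp_decomp M M0 A) (iN : iso (F M0) N) (iQ : iso (F A) Q).

Let fM0 : susp_free M0. Proof. by case: dM. Qed.
Let TA : idsum T A. Proof. by case: dM. Qed.
Let iM : iso M (M0 ⊕ S A). Proof. by case: dM. Qed.
Let FMN : iso (F M) N. Proof. exact: iso_trans (susp_decomp_F T_ct dM) iN. Qed.

Lemma rel0_decomp_r X : rel0 X M <-> rel0 X M0.
Proof.
rewrite (rel0_iso (iso_refl X) iM) rel0_bip_r; split=> [[]|] //.
by split=> //; apply: rel0_susp_r.
Qed.

Lemma rel0_decomp_l Y (P : mods) : iso (F Y) P -> rel0 M Y <-> rel0 M0 Y /\ Hom0 Q P.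
Proof.
move=> iP; rewrite (rel0_iso iM (iso_refl Y)) rel0_bip_l.
by rewrite (rel0_susp_l TA iQ iP).
Qed.

Lemma rel0_decomp_tau Y (P : mods) : iso (F Y) P ->
  rel0 M Y <-> Hom0 P (tau N) /\ Hom0 Q P.
Proof.
by move=> iP; rewrite (rel0_decomp_l iP) (rel0_tau C_split T_ct fM0 iN iP).
Qed.

Lemma rel0_tau_decomp Y (P : mods) : susp_free Y -> iso (F Y) P ->
  rel0 Y M <-> Hom0 N (tau P).
Proof. by move=> fY iP; rewrite (rel0_tau C_split T_ct fY iP FMN). Qed.

Lemma idsum_decomp_free Y (P : mods) : susp_free Y -> iso (F Y) P ->
  idsum M Y <-> addmod N P.
Proof.
move=> fY iP; rewrite addmodP -(idsum_iso FMN iP).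
by split=> [|/(reflect_idsum_free C_split T_ct fY)] //; apply: F_idsum.
Qed.

(** The summand [M0] does not contribute to [S B], by [idsum_free_cancel]. *)
Lemma idsum_decomp_susp B (P : mods) : idsum T B -> iso (F B) P ->
  idsum M (S B) <-> addmod Q P.
Proof.
move=> TB iP; rewrite addmodP -(idsum_iso iQ iP).
rewrite (idsum_iso iM (iso_refl _)).
transitivity (idsum (S A) (S B)).
  split; first by apply: (idsum_free_cancel C_split fM0); apply: susp_idsum.
  exact: idsum_retract_gen (retract_in2 _ _).
rewrite idsum_susp; split; first exact: F_idsum.
exact: (reflect_idsum_proj T_ct TB).
Qed.

Lemma rel_rigid_pair : rel0 M M <-> tau_rigid_pair m.+1 (N, Q).
Proof.
rewrite (rel0_decomp_tau FMN); split=> [[rN QN]|[_ rN QN]] //; split=> //; split.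
  by exists M0; apply/mod_isoP.
apply/projectiveP; apply: dual_retract (F_dual TA).
exact/iso_retract/iso_sym.
Qed.

(** Adding an object [Y = Y0 + S B] to [M] means adding [F Y0] to the first and
    [F B] to the second component.  A pair may be enlarged in either component
    separately, and so may [M]: it suffices to test [Y = Y0] and [Y = S B]. *)
Lemma max_rel_rigid_pair :
  max_rel_rigid S T M <-> support_tau_tilting_pair m.+1 (N, Q).
Proof.
have F_bip_iso Y (P : mods) : iso (F Y) P -> iso (F (M0 ⊕ Y)) (rsum N P : mods).
  by move=> iP; apply: iso_trans (F_bip _ _ _) (iso_bip iN iP).
split=> [[rM maxM]|[/rel_rigid_pair rM maxN maxQ]].
  split=> [|P [Y /mod_isoP iY]|P]; first exact/rel_rigid_pair.
    have [Y0 [B dY]] := susp_decomp_exists C_split S T Y; have [fY0 _ _] := dY.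
    have iP : iso (F Y0) P by apply: iso_trans (iso_sym (susp_decomp_F T_ct dY)) iY.
    move=> [_ /= rNP QNP]; apply/(idsum_decomp_free fY0 iP)/addob_idsum; apply: maxM.
    have := (rel0_tau C_split T_ct (susp_free_bip C_split fM0 fY0)
      (F_bip_iso _ _ iP) (F_bip_iso _ _ iP)).2 rNP.
    move/rel0_bip => [_ M0Y0 Y0M0 Y0Y0]; apply/rel0_bip; split=> //.
      apply/(rel0_decomp_l iP); split=> //.
      apply: Hom0_retract QNP; first exact/iso_retract/iso_refl.
      exact: (retract_in2 N P).
    exact/rel0_decomp_r.
  move=> /projectiveP Pdual.
  have [B TB iP] := projective_F C_split ((projectiveP _).2 Pdual).
  have BM := rel0_susp_l TB iP FMN.
  rewrite -BM -(idsum_decomp_susp TB iP); split=> [MB|rBM].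
    apply/BM; apply/Hom0P; apply: (@zero_hom_idsum _ _ Q).
      by apply/addmodP/(idsum_decomp_susp TB iP).
    by apply/Hom0P; case/rel_rigid_pair: rM.
  apply: addob_idsum; apply: maxM; apply/rel0_bip; split=> //; exact: rel0_susp_r.
split=> // Y /rel0_bip [_ MY YM YY]; apply/(addob_idsumP C_split).
have [Y0 [B dY]] := susp_decomp_exists C_split S T Y; have [fY0 TB iY] := dY.
have Y0Y : retract Y0 Y.
  exact: retract_trans (retract_in1 _ _) (iso_retract (iso_sym iY)).
have BY : retract (S B) Y.
  exact: retract_trans (retract_in2 _ _) (iso_retract (iso_sym iY)).
have MM := iso_retract (iso_refl M).
apply: idsum_retract (iso_retract iY) _; apply: idsum_bip.
  have MY0 := rel0_retract MM Y0Y MY; have Y0M := rel0_retract Y0Y MM YM.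
  apply/(idsum_decomp_free fY0 (iso_refl _)); apply: maxN.
    by exists Y0; apply/mod_isoP/iso_refl.
  have iP := F_bip_iso _ _ (iso_refl (F Y0)).
  have [/(rel0_decomp_l (iso_refl (F Y0))) [M0Y0 QY0] /rel0_decomp_r Y0M0] := (MY0, Y0M).
  have [[_ projQ] _ QN] := rel_rigid_pair.1 rM.
  split=> /=; first by split=> //; exists (M0 ⊕ Y0); apply/mod_isoP.
    apply/(rel0_tau C_split T_ct (susp_free_bip C_split fM0 fY0) iP iP)/rel0_bip.
    split=> //; last exact: (rel0_retract Y0Y Y0Y YY).
    by apply/rel0_decomp_r; have [] := (rel0_decomp_l FMN).1 rM.
  apply/Hom0P => f; apply: (bip_ext_pr (C := mods) (X := N) (Y := F Y0));
    rewrite compm0; move/Hom0P: QN; move/Hom0P: QY0 => H H'; [exact: H' | exact: H].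
apply/(idsum_decomp_susp TB (iso_refl _)); apply/maxQ.
  by apply/projectiveP/F_dual.
apply/(rel0_susp_l TB (iso_refl _) FMN).
exact: rel0_retract BY MM YM.
Qed.

(** Both conditions of self-perpendicularity split along [Y = Y0 + S B].  The part
    for [Y0] is the condition on modules in [D], the part for [S B] the condition
    on projective modules. *)
Lemma self_perpendicular_pair :
  self_perpendicular S T M <-> max_tau_rigid_pair m.+1 (N, Q).
Proof.
have free_iff Y (P : mods) : susp_free Y -> iso (F Y) P ->
    ((rel0 M Y /\ rel0 Y M) <-> [/\ Hom0 N (tau P), Hom0 P (tau N) & Hom0 Q P]).
  move=> fY iP; rewrite (rel0_decomp_tau iP) (rel0_tau_decomp fY iP).
  by split=> [[[? ?] ?]|[]].
have susp_iff B (P : mods) : idsum T B -> iso (F B) P ->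
    ((rel0 M (S B) /\ rel0 (S B) M) <-> Hom0 P N).
  move=> TB iP; rewrite (rel0_susp_l TB iP FMN).
  by split=> [[]|] //; split=> //; apply: rel0_susp_r.
split=> [self|[isp maxN maxQ] Y].
  split=> [|P [Y /mod_isoP iY]|P].
  - have : rel0 M M by have [] := (self M).1 (idsum_addob C_split (idsum_refl M)).
    by case/rel_rigid_pair.
  - have [Y0 [B dY]] := susp_decomp_exists C_split S T Y; have [fY0 _ _] := dY.
    have iP : iso (F Y0) P by apply: iso_trans (iso_sym (susp_decomp_F T_ct dY)) iY.
    by rewrite -(free_iff _ _ fY0 iP) -(idsum_decomp_free fY0 iP) -addob_idsumP.
  move=> /(projective_F C_split) [B TB iP].
  by rewrite -(susp_iff _ _ TB iP) -(idsum_decomp_susp TB iP) -addob_idsumP.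
have [Y0 [B dY]] := susp_decomp_exists C_split S T Y; have [fY0 TB iY] := dY.
rewrite addob_idsumP // (idsum_iso (iso_refl M) iY).
transitivity (idsum M Y0 /\ idsum M (S B)).
  split=> [H|[]]; last exact: idsum_bip.
  by split; apply: idsum_retract H; [apply: retract_in1 | apply: retract_in2].
have projFB : projective (F B) by apply/projectiveP/F_dual.
have DY0 : inD (F Y0) by exists Y0; apply/mod_isoP/iso_refl.
rewrite (idsum_decomp_free fY0 (iso_refl _)) (idsum_decomp_susp TB (iso_refl _)).
rewrite (maxN _ DY0) (maxQ _ projFB).
rewrite -(free_iff _ _ fY0 (iso_refl _)) -(susp_iff _ _ TB (iso_refl _)).
rewrite -/(rel0 M Y) -/(rel0 Y M).
rewrite (rel0_iso (iso_refl M) iY) (rel0_iso iY (iso_refl M)) rel0_bip_l rel0_bip_r.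
by split=> [[[? ?] [? ?]]|[[? ?] [? ?]]].
Qed.

End OnePair.

Lemma pair_ofP M p : pair_of S M p <->
  exists M0 A,
    [/\ susp_decomp M M0 A, iso (F M0) (p.1 : mods) & iso (F A) (p.2 : mods)].
Proof.
split=> [[M0 [A [/(max_decompositionP C_split) d [/mod_isoP i1 /mod_isoP i2]]]]|].
  by exists M0, A.
move=> [M0 [A [d i1 i2]]]; exists M0, A.
by split; [apply/max_decompositionP | split; apply/mod_isoP].
Qed.

(** Every pair [(F X0, F A)] comes from [X0 + S A], so only the compatibility of the
    two properties depends on the case. *)
Lemma pair_class_bijection (PA : C -> Prop) (PB : mod_pair T -> Prop) :
  (forall M p, pair_of S M p -> PA M <-> PB p) -> (forall p, PB p -> is_pair p) ->
  class_bijection PA (@iso k C) PB (@pair_iso k C T) (pair_of S).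
Proof.
move=> AB Bpair; split=> [M _|M p PM Mp|M M' p p' _ _|p Bp].
- have [M0 [A d]] := susp_decomp_exists C_split S T M; exists (homT T M0, homT T A).
  by apply/pair_ofP; exists M0, A; split=> //; apply: iso_refl.
- exact/(AB M p Mp).
- move=> /pair_ofP [M0 [A [d i1 i2]]] /pair_ofP [M0' [A' [d' i1' i2']]].
  rewrite (susp_decomp_iso C_split T_ct d d') /pair_iso !mod_isoP.
  split=> -[e1 e2]; split.
  + exact: iso_trans (iso_sym i1) (iso_trans e1 i1').
  + exact: iso_trans (iso_sym i2) (iso_trans e2 i2').
  + exact: iso_trans i1 (iso_trans e1 (iso_sym i1')).
  exact: iso_trans i2 (iso_trans e2 (iso_sym i2')).
have [[X /mod_isoP iX] /(projective_F C_split) [A TA iA]] := Bpair p Bp.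
have [X0 [B dX]] := susp_decomp_exists C_split S T X; have [fX0 _ _] := dX.
have pM : pair_of S (X0 ⊕ S A) p.
  apply/pair_ofP; exists X0, A; split=> //; first by split=> //; apply: iso_refl.
  exact: iso_trans (iso_sym (susp_decomp_F T_ct dX)) iX.
by exists (X0 ⊕ S A) => //; apply/(AB _ _ pM).
Qed.

End Pairs.

Theorem theorem1p5 (k : fieldType) (n : nat) (n_gt0 : (0 < n)%N)
    (C : lincat k) (C_split : split_idempotents C) (S : angulation C n)
    (T : C) (T_ct : cluster_tilting S T) :
  [/\ (forall M : C,
         (forall X : C, addob M X -> addob (S T) X -> iso X (zob C)) ->
         (rel_rigid S T M <-> tau_rigid n (homT T M))),
      (forall M : C, exists M0 TM, max_decomposition S T M M0 TM) /\
      class_bijection (rel_rigid S T) (@iso k C)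
        (@tau_rigid_pair k C T n) (@pair_iso k C T) (pair_of S),
      class_bijection (max_rel_rigid S T) (@iso k C)
        (@support_tau_tilting_pair k C T n) (@pair_iso k C T) (pair_of S) &
      class_bijection (self_perpendicular S T) (@iso k C)
        (@max_tau_rigid_pair k C T n) (@pair_iso k C T) (pair_of S)].
Proof.
case: n n_gt0 S T_ct => // m _ S T_ct; split.
- move=> M MT; have fM : susp_free S T M.
    move=> W TW WM; apply: (zero_retract _ (zobP C)); apply: iso_retract.
    apply: MT; apply: idsum_addob => //.
    by apply: idsum_retract WM _; apply: idsum_refl.
  exact: (rel0_tau C_split T_ct fM (iso_refl (homT T M : modcat (endalg T)))
    (iso_refl _)).
- split=> [M|].
    have [M0 [A d]] := susp_decomp_exists C_split S T M; exists M0, A.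
    exact/max_decompositionP.
  apply: pair_class_bijection => // [M [N Q]|p [] //].
  move=> /(pair_ofP C_split) [M0 [A [d i1 i2]]].
  exact: (rel_rigid_pair C_split T_ct d i1 i2).
- apply: pair_class_bijection => // [M [N Q]|p [[] //]].
  move=> /(pair_ofP C_split) [M0 [A [d i1 i2]]].
  exact: (max_rel_rigid_pair C_split T_ct d i1 i2).
apply: pair_class_bijection => // [M [N Q]|p [] //].
move=> /(pair_ofP C_split) [M0 [A [d i1 i2]]].
exact: (self_perpendicular_pair C_split T_ct d i1 i2).
Qed.
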